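(* Let $(t,y_1,y_2)$ be a random vector whose probability density is proportional to $t$ on the set $$\{(t,y_1,y_2)\in\mathbb R^3:\ t>0,\ t^2\le y_1^2+y_2^2+1/t^2,\ 2|y_1|\le t,\ 2|y_2|\le t\}$$ and zero elsewhere, and set $$\xi_R=\frac{y_1}{\sqrt{y_1^2+y_2^2+1/t^2}},\qquad \xi_I=\frac{y_2}{\sqrt{y_1^2+y_2^2+1/t^2}}.$$ Then $(\xi_R,\xi_I)$ has joint probability density function $$-\frac3C\;\frac{\log\big(4\max(|\xi_R|^2,|\xi_I|^2)\big)}{4\,(1-\xi_R^2-\xi_I^2)^2}$$ supported on $\max(|\xi_R|^2,|\xi_I|^2)\le 1/4$, where $C=\sum_{n=1}^\infty\frac{(-1)^{n-1}}{(2n-1)^2}$ is Catalan's constant.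
   Context: Interpretation: for a random lattice from $\mathrm{SL}_2(\mathbb C)/\mathrm{SL}_2(\mathbb Z[i])$ with shortest reduced basis $\{\boldsymbol\alpha,\boldsymbol\beta\}$ over the Gaussian integers, written in Gram–Schmidt coordinates $\boldsymbol\alpha=(t,0)$, $\boldsymbol\beta=(y_1+iy_2,1/t)$, the invariant measure gives $(t,y_1,y_2)$ the stated density, and $\xi_R+i\xi_I=\overline{\boldsymbol\alpha}\cdot\boldsymbol\beta/(\|\boldsymbol\alpha\|\,\|\boldsymbol\beta\|)$. *)

(* Defs.v *)
From HB Require Import structures.
From mathcomp Require Import all_boot all_order all_algebra.
From mathcomp Require Import all_classical all_reals all_analysis.

Set Implicit Arguments.
Unset Strict Implicit.
Unset Printing Implicit Defensive.
Import Order.TTheory GRing.Theory Num.Theory.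
Import numFieldNormedType.Exports.
Local Open Scope classical_set_scope.
Local Open Scope ring_scope.

Definition has_density (d d' : measure_display) (T : measurableType d)
    (U : measurableType d') (R : realType) (P : probability T R)
    (mu : {measure set U -> \bar R}) (X : T -> U) (f : U -> R) : Prop :=
  [/\ measurable_fun [set: T] X,
      measurable_fun [set: U] f,
      forall u, 0 <= f u
    & forall A, measurable A ->
        pushforward P X A = (\int[mu]_(u in A) (f u)%:E)%E].

Definition lebesgue2 (R : realType) :
    {measure set (measurableTypeR R * measurableTypeR R) -> \bar R} :=
  (@lebesgue_measure R \x @lebesgue_measure R)%E.

Definition lebesgue3 (R : realType) :
    {measure set (measurableTypeR R * measurableTypeR R * measurableTypeR R)
       -> \bar R} :=
  (@lebesgue_measure R \x @lebesgue_measure R \x @lebesgue_measure R)%E.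

Definition reduced_domain (R : realType) : set (R * R * R) :=
  [set v | let: (t, y1, y2) := v in
    [/\ 0 < t,
        t ^+ 2 <= y1 ^+ 2 + y2 ^+ 2 + 1 / t ^+ 2,
        2 * `|y1| <= t
      & 2 * `|y2| <= t]].

Definition catalan (R : realType) : R :=
  limn (fun N : nat =>
    \sum_(1 <= n < N) ((-1) ^+ n.-1 / (n.*2.-1)%:R ^+ 2 : R) : R).

Definition max_sq (R : realType) (x y : R) : R :=
  Num.max (`|x| ^+ 2) (`|y| ^+ 2).

(* At the origin, a null set where the closed formula diverges to +oo, this
   function vanishes because [ln 0 = 0]. *)
Definition xi_density (R : realType) (z : R * R) : R :=
  let: (x, y) := z in
  - (3 / catalan R) *
    (ln (4 * max_sq x y) / (4 * (1 - x ^+ 2 - y ^+ 2) ^+ 2)) *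
  \1_[set p : R * R | max_sq p.1 p.2 <= 1 / 4] z.

(* Main.v *)
Require Import Defs.
From HB Require Import structures.
From mathcomp Require Import all_boot all_order all_algebra.
From mathcomp Require Import all_classical all_reals all_analysis.
From mathcomp Require Import measurable_realfun ring lra.

Set Implicit Arguments.
Unset Strict Implicit.
Unset Printing Implicit Defensive.
Import Order.TTheory GRing.Theory Num.Theory.
Import numFieldNormedType.Exports.
Local Open Scope classical_set_scope.
Local Open Scope ring_scope.

(** Two integrals of the density [c t] over the reduced domain have to be found:
its total mass, which determines [c], and the mass of the points whose image
(xi_R, xi_I) lies in a Borel set. Two different charts are used.

For the law, fix t > 0. The map y |-> y / sqrt (|y|^2 + 1/t^2) is a bijection
of the plane onto the open unit disc; its inverse is xi |-> xi / (t rho) with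
rho = sqrt (1 - |xi|^2), and the Jacobian of the inverse is 1 / (t^2 rho^4)
([ge0_integral_ball_chart]). The bijection is a composition of two maps that
each move one coordinate, so Tonelli's theorem and a one-dimensional
substitution are enough. With m = max(xi_R^2, xi_I^2), the reduced domain
becomes the condition 4 m <= t^4 rho^2 <= 1 ([reduced_domain_chart]).
Integrating t / (t^2 rho^4) over these t gives - ln (4 m) / (4 rho^4)
([integral_inv_quartic]), which is the claimed density up to the factor [c]
([integral_xi_map]).

For the mass, substitute y_i = t a_i / 2 instead. The a_i range over [-1, 1]
and t over t^4 (4 - a_1^2 - a_2^2) <= 4, so that the integral over t is
elementary and the mass is the integral of 1 / (4 (4 - a^2 - b^2)) over the
square [-1, 1]^2 ([mass_square]). By symmetry it is enough to integrate over the
two triangles |b| <= |a|, and the mass becomes the integral over x in [0, 1] of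
(ln (d + x) - ln (d - x)) / d with d = sqrt (4 - x^2)
([integral_square_density]). This function of x is itself an integral over r in
]0, 1[ of a rational function of x and r, whose integral over x is
(atan r - atan r^3) / (2 r); exchanging the two integrations turns logarithms
into arctangents ([integral_log_slice_atan]). Finally the integral of
(atan r) / r over [0, 1] is Catalan's constant C, by integrating the power
series of atan term by term, and the substitution r^3 -> r shows that the
second term contributes C / 3. The mass is (C - C / 3) / 2 = C / 3
([integral_atan_gap]), hence c = 3 / C. *)

(** * Measurability and substitution on the real line *)

Section real_measurability.
Context {R : realType}.

Lemma measurable_invr : measurable_fun [set: R] (@GRing.inv R).
Proof.
have -> : [set: R] = [set r : R | r != 0] `|` [set 0].
  apply/seteqP; split => // x _ /=; have [->|x0] := eqVneq x 0;
    by [right|left].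
apply/measurable_funU => //; first exact: open_measurable.
split; last exact: measurable_fun_set1.
apply: open_continuous_measurable_fun => //; apply/in_setP => x /= x0.
exact: inv_continuous.
Qed.

Lemma measurable_sqrtr : measurable_fun [set: R] (@Num.sqrt R).
Proof. by apply: continuous_measurable_fun; exact: sqrt_continuous. Qed.

End real_measurability.

Section transfer.
Import HBNNSimple.

(** Approximating f from below by simple functions reduces the identity to its
instance for indicators, which is the hypothesis on [nu]. The map and the weight
are treated together because a change of variables produces both at once: the
new point and the Jacobian. *)
Lemma ge0_integral_transfer d1 d2 (X : measurableType d1)
    (Y : measurableType d2) (R : realType)
    (mu : {measure set X -> \bar R}) (nu : {measure set Y -> \bar R})
    (phi : X -> Y) (w : X -> R) :
  measurable_fun setT phi -> measurable_fun setT w ->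
  (forall x, 0 <= w x) ->
  (forall A, measurable A -> nu A = \int[mu]_(x in phi @^-1` A) (w x)%:E)%E ->
  forall f : Y -> \bar R, measurable_fun setT f -> (forall y, 0 <= f y)%E ->
  (\int[nu]_y f y = \int[mu]_x (f (phi x) * (w x)%:E))%E.
Proof.
move=> mphi mw w0 nuE f mf f0.
have mwE : measurable_fun setT (fun x => (w x)%:E) by exact/measurable_EFinP.
pose f_ := nnsfun_approx measurableT mf.
have mfphi n : measurable_fun setT (fun x => (f_ n (phi x))%:E).
  by apply/measurable_EFinP; apply: measurableT_comp.
transitivity (limn (fun n => \int[nu]_x (f_ n x)%:E)%E).
  rewrite -monotone_convergence//.
  - apply: eq_integral => y _; apply/esym/cvg_lim => //.
    exact: cvg_nnsfun_approx.
  - by move=> n; exact/measurable_EFinP/measurable_funP.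
  - by move=> n y _; rewrite lee_fin.
  - by move=> y _ m n mn; rewrite lee_fin; exact/lefP/nd_nnsfun_approx.
rewrite [X in limn X](_ : _ =
    (fun n => \int[mu]_x ((f_ n (phi x))%:E * (w x)%:E))%E).
  rewrite -monotone_convergence//; last 3 first.
    - by move=> n; apply: emeasurable_funM.
    - by move=> n x _ /=; rewrite mule_ge0// lee_fin.
    - move=> x _ m n mn; rewrite lee_pmul// ?lee_fin//.
      exact/lefP/nd_nnsfun_approx.
  apply: eq_integral => x _ /=; apply/cvg_lim => //.
  by apply: cvgeZr => //; exact: cvg_nnsfun_approx.
apply/funext => n.
have mpre r : measurable (f_ n @^-1` [set r]) by exact: measurable_sfunP.
have mpre' r : measurable (phi @^-1` (f_ n @^-1` [set r])).
  by rewrite -[X in measurable X]setTI; exact: mphi.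
transitivity (\sum_(k \in range (f_ n))
    \int[mu]_x
      (k%:E * ((\1_(phi @^-1` (f_ n @^-1` [set k])) x)%:E * (w x)%:E)))%E.
  rewrite integralT_nnsfun sintegralE; apply: eq_fsbigr => k _.
  have [k0|k0] := leP 0 k; last first.
    have -> : f_ n @^-1` [set k] = set0.
      apply/seteqP; split => // y /= yk.
      have : (0 <= f_ n y)%R by [].
      by rewrite yk leNgt k0.
    rewrite measure0 mule0 integral0_eq// => x _.
    by rewrite preimage_set0 indic0 mul0e mule0.
  rewrite ge0_integralZl//; last 2 first.
    - by apply: emeasurable_funM => //; apply/measurable_EFinP/measurable_indic.
    - by move=> x _; rewrite mule_ge0// lee_fin.
  congr (_ * _)%E; rewrite nuE// integral_mkcond; apply: eq_integral => x _.
  rewrite patchE indicE; case: ifPn => /= h; last by rewrite mul0e.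
  by rewrite mul1e.
rewrite -ge0_integral_fsum//.
- apply: eq_integral => x _; rewrite (fimfunE (f_ n) (phi x)).
  rewrite -fsumEFin// ge0_mule_fsuml//.
    by apply: eq_fsbigr => r _; rewrite EFinM muleA.
  by move=> r; exact: nnfun_muleindic_ge0.
- move=> r; apply: measurable_funeM.
  by apply: emeasurable_funM => //; apply/measurable_EFinP/measurable_indic.
- move=> r x _; rewrite muleA mule_ge0 ?lee_fin//.
  have [r0|r0] := leP 0 r; first by rewrite mulr_ge0.
  have -> : f_ n @^-1` [set r] = set0.
    apply/seteqP; split => // y /= yk.
    have : (0 <= f_ n y)%R by [].
    by rewrite yk leNgt r0.
  by rewrite preimage_set0 indic0 mulr0.
Qed.

End transfer.

Section density_measure.
Context d (X : measurableType d) (R : realType).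
Variables (mu : {measure set X -> \bar R}) (w : X -> R).
Hypothesis mw : measurable_fun setT w.
Hypothesis w0 : forall x, 0 <= w x.

(** The two proofs are arguments so that the measure structure declared below
can be inferred from the term alone. *)
Definition density_measure of (measurable_fun setT w) & (forall x, 0 <= w x) :=
  fun A : set X => (\int[mu]_(x in A) (w x)%:E)%E.

Let nu := density_measure mw w0.

Let nu0 : nu set0 = 0%E.
Proof. by rewrite /nu /density_measure integral_set0. Qed.

Let nu_ge0 A : (0 <= nu A)%E.
Proof. by apply: integral_ge0 => x _; rewrite lee_fin. Qed.

Let nu_sigma_additive : semi_sigma_additive nu.
Proof.
move=> /= F mF tF mUF; rewrite /nu /density_measure; apply: cvg_toP.
  apply: ereal_nondecreasing_is_cvgn => m n mn.
  apply: lee_sum_nneg_natr => // k _ _.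
  by apply: integral_ge0 => /= x Fkx; rewrite lee_fin.
rewrite ge0_integral_bigcup//=; last by move=> x _; rewrite lee_fin.
by apply: measurable_funTS; exact/measurable_EFinP.
Qed.

HB.instance Definition _ := isMeasure.Build _ _ _ (density_measure mw w0)
  nu0 nu_ge0 nu_sigma_additive.

End density_measure.

Section substitution.
Context {R : realType}.
Notation mu := (@lebesgue_measure R).

Lemma integral_derivative (F f : R -> R) (a b : R) : a <= b ->
  (forall x, a <= x <= b -> is_derive x 1 F (f x)) ->
  (forall x, a <= x <= b -> {for x, continuous f}) ->
  (\int[mu]_(x in `[a, b]) (f x)%:E = (F b - F a)%:E)%E.
Proof.
rewrite le_eqVlt => /predU1P[<- _ _|ab dF cf].
  by rewrite set_itv1 integral_set1 subrr.
have cF x : a <= x <= b -> {for x, continuous F}.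
  move=> /dF dFx; apply: differentiable_continuous.
  by apply/derivable1_diffP; exact: ex_derive.
rewrite EFinB; apply: continuous_FTC2 => //.
- apply: continuous_in_subspaceT => x; rewrite inE/= in_itv/=; exact: cf.
- split.
  + move=> x; rewrite in_itv/= => /andP[ax xb]; apply: ex_derive.
    by apply: dF; rewrite !ltW.
  + by apply: cvg_at_right_filter; apply: cF; rewrite lexx ltW.
  + by apply: cvg_at_left_filter; apply: cF; rewrite lexx ltW.
- move=> x; rewrite in_itv/= => /andP[ax xb]; rewrite derive1E.
  by apply: derive_val; apply: dF; rewrite !ltW.
Qed.

(** Lebesgue measure is the only measure that gives each interval ]a, b] its
length. The image under G of the measure of density w does so, because G is an
antiderivative of w and the preimage of ]a, b] is ]h a, h b]. Identifying the
two measures gives the formula for every measurable f; the integrands to which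
it is applied contain indicators of Borel sets and are not continuous. *)
Lemma ge0_integral_substitution (D : set R) (G h w : R -> R) :
  measurable D -> measurable_fun setT G -> measurable_fun setT w ->
  (forall x, 0 <= w x) ->
  (forall y, D (h y)) -> (forall y, G (h y) = y) ->
  (forall x, D x -> h (G x) = x) -> {mono h : a b / a <= b} ->
  is_interval D ->
  (forall x, D x -> is_derive x 1 G (w x)) ->
  (forall x, D x -> {for x, continuous w}) ->
  forall f : R -> \bar R, measurable_fun setT f -> (forall y, 0 <= f y)%E ->
  (\int[mu]_y f y = \int[mu]_(x in D) (f (G x) * (w x)%:E))%E.
Proof.
move=> mD mG mw w0 Dh Gh hG h_le itvD dG cw f mf f0.
have h_lt := leW_mono h_le.
have Gitv a b x : D x -> (a < G x <= b) = (h a < x <= h b).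
  by move=> Dx; rewrite -[in RHS](hG x Dx) h_lt h_le.
have Dcvx a b x : h a <= x <= h b -> D x by apply: itvD.
pose wD x := w x * \1_D x.
have mwD : measurable_fun setT wD.
  by apply: measurable_funM => //; exact: measurable_indic.
have wD0 x : 0 <= wD x by rewrite mulr_ge0.
pose nu : {measure set (measurableTypeR R) -> \bar R} :=
    density_measure mu mwD wD0.
have muE A : measurable A -> (mu A = \int[mu]_(x in G @^-1` A) (wD x)%:E)%E.
  move=> mA.
  pose mG_mixin := isMeasurableFun.Build _ _ (measurableTypeR R)
    (measurableTypeR R) G mG.
  pose mG_pack : {mfun (measurableTypeR R) >-> (measurableTypeR R)} :=
    HB.pack (G : measurableTypeR R -> measurableTypeR R) mG_mixin.
  rewrite (@lebesgue_measure_unique R (pushforward nu mG_pack))//.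
  move=> _ [[a b] _ <-]; rewrite /pushforward /= /nu /density_measure.
  rewrite /pushforward/=; have [ab|ba] := ltP a b; last first.
    by rewrite set_itv_ge ?bnd_simp -?leNgt// preimage_set0 measure0
      integral_set0.
  have hab : h a < h b.
    by have := Gitv a b (h b) (Dh b); rewrite Gh ab !lexx !andbT => <-.
  rewrite lebesgue_measure_itv/= lte_fin ab.
  transitivity (\int[mu]_(x in `]h a, h b]) (w x)%:E)%E; last first.
    rewrite /density_measure [LHS]integral_mkcond [RHS]integral_mkcond.
    apply: eq_integral => x _; rewrite !patchE /wD indicE.
    have [xD|xD] := boolP (x \in D).
      rewrite mulr1; move/set_mem in xD; congr (if _ then _ else _).
      by apply/idP/idP; rewrite !inE/= !in_itv/= Gitv.
    rewrite mulr0 if_same; case: ifPn => //.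
    rewrite inE/= in_itv/= => /andP[hax xhb].
    move: xD => /negP; elim; apply/mem_set/(Dcvx a b).
    by rewrite (ltW hax) xhb.
  rewrite integral_itv_obnd_cbnd; last first.
    by apply: measurable_funTS; exact/measurable_EFinP.
  have -> := integral_derivative (ltW hab) (fun x xab => dG x (Dcvx a b x xab))
    (fun x xab => cw x (Dcvx a b x xab)).
  by rewrite !Gh.
rewrite (@ge0_integral_transfer _ _ (measurableTypeR R) (measurableTypeR R) R
  mu mu G wD mG mwD wD0 muE f mf f0).
rewrite [RHS]integral_mkcond; apply: eq_integral => x _.
rewrite patchE /wD indicE; case: (x \in D); first by rewrite mulr1.
by rewrite mulr0 mule0.
Qed.
End substitution.

Section measurable_fun_ext.
Context d (T : measurableType d) (R : realType) (D : set T).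
Implicit Types f g : T -> R.

Lemma measurable_funV f :
  measurable_fun D f -> measurable_fun D (fun x => (f x)^-1).
Proof. by move=> mf; apply: (measurableT_comp measurable_invr). Qed.

Lemma measurable_funsqrt f :
  measurable_fun D f -> measurable_fun D (fun x => Num.sqrt (f x)).
Proof. by move=> mf; apply: (measurableT_comp measurable_sqrtr). Qed.

Lemma measurable_funln f :
  measurable_fun D f -> measurable_fun D (fun x => ln (f x)).
Proof. by move=> mf; apply: (measurableT_comp (@measurable_ln R)). Qed.

Lemma measurable_funnorm f :
  measurable_fun D f -> measurable_fun D (fun x => `|f x|).
Proof. by move=> mf; apply: (measurableT_comp (@normr_measurable R setT)). Qed.

End measurable_fun_ext.

(** Measurability of an expression by recursion on its syntax. *)
Ltac mfun := repeat match goal with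
  | |- measurable_fun _ (fun x => @?f x + - @?g x) => apply: measurable_funB
  | |- measurable_fun _ (fun x => @?f x + @?g x) => apply: measurable_funD
  | |- measurable_fun _ (fun x => - @?f x) => apply: measurable_funN
  | |- measurable_fun _ (fun x => @?f x * @?g x) => apply: measurable_funM
  | |- measurable_fun _ (fun x => @?f x ^+ ?n) => apply: measurable_funX
  | |- measurable_fun _ (fun x => (@?f x)^-1) => apply: measurable_funV
  | |- measurable_fun _ (fun x => Num.sqrt (@?f x)) => apply: measurable_funsqrt
  | |- measurable_fun _ (fun x => ln (@?f x)) => apply: measurable_funln
  | |- measurable_fun _ (fun x => `|@?f x|) => apply: measurable_funnorm
  | |- measurable_fun _ (fun x => Num.max (@?f x) (@?g x)) =>
      apply: measurable_maxr
  | |- measurable_fun _ (fun x => (@?f x, @?g x)) =>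
      apply: measurable_fun_pair
  | |- measurable_fun _ (fun x => fst (@?f x)) =>
      apply: (measurableT_comp measurable_fst)
  | |- measurable_fun _ (fun x => snd (@?f x)) =>
      apply: (measurableT_comp measurable_snd)
  | |- measurable_fun _ (GRing.mul _) =>
      exact: (measurable_funM (measurable_cst _) (@measurable_id _ _ _))
  | |- measurable_fun _ _ =>
      first [exact: measurable_id | exact: measurable_cst
            | exact: measurable_fst | exact: measurable_snd | assumption]
  end.

(** * The chart of the unit disc *)

Section projective_substitution.
Context {R : realType}.
Notation mu := (@lebesgue_measure R).

Lemma sqrt_ratio_mono (b : R) : 0 < b ->
  {mono (fun y => y / Num.sqrt (b ^+ 2 + y ^+ 2)) : x y / x <= y}.
Proof.
move=> b0; apply: le_mono => x y xy.
have s0 z : 0 < Num.sqrt (b ^+ 2 + z ^+ 2).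
  by rewrite sqrtr_gt0 ltr_wpDr ?sqr_ge0 ?exprn_gt0.
have s2 z : Num.sqrt (b ^+ 2 + z ^+ 2) ^+ 2 = b ^+ 2 + z ^+ 2.
  by rewrite sqr_sqrtr// addr_ge0 ?sqr_ge0.
rewrite ltr_pdivrMr// mulrAC ltr_pdivlMr//.
have := s2 x; have := s2 y; have := s0 x; have := s0 y.
set u := Num.sqrt (b ^+ 2 + x ^+ 2); set v := Num.sqrt (b ^+ 2 + y ^+ 2).
move=> v0 u0 v2 u2.
have b20 : 0 < b ^+ 2 by rewrite exprn_gt0.
have [x0|x0] := leP 0 x.
  have y0 : 0 < y by exact: le_lt_trans xy.
  rewrite -(@ltr_pXn2r _ 2) ?nnegrE ?mulr_ge0 ?(ltW u0) ?(ltW v0) ?(ltW y0)//.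
  rewrite !exprMn u2 v2.
  have : x ^+ 2 < y ^+ 2 by rewrite ltr_pXn2r ?nnegrE// ltW.
  by nra.
have [y0|y0] := leP 0 y.
  by rewrite (@lt_le_trans _ _ 0) ?nmulr_rlt0 ?mulr_ge0 ?(ltW u0)//.
rewrite -ltrN2 -!mulNr -(@ltr_pXn2r _ 2) ?nnegrE ?mulr_ge0 ?oppr_ge0
  ?(ltW u0) ?(ltW v0) ?(ltW y0) ?(ltW x0)//.
rewrite !exprMn u2 v2 !sqrrN.
have : y ^+ 2 < x ^+ 2.
  by rewrite -[ltLHS]sqrrN -[ltRHS]sqrrN ltr_pXn2r ?nnegrE ?oppr_ge0 ?ltrN2//
    ltW.
by nra.
Qed.

(** The inverse of G x = b x / sqrt (k^2 - x^2) on ]-k, k[ is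
y |-> k y / sqrt (b^2 + y^2), and G' x = b k^2 / (k^2 - x^2)^(3/2). *)
Lemma ge0_integral_sqrt_ratio (b k : R) (f : R -> \bar R) : 0 < b -> 0 < k ->
  measurable_fun setT f -> (forall y, 0 <= f y)%E ->
  (\int[mu]_y f y = \int[mu]_(x in `](- k)%R, k[)
     (f (b * x / Num.sqrt (k ^+ 2 - x ^+ 2))%R *
      (b * k ^+ 2 / Num.sqrt (k ^+ 2 - x ^+ 2) ^+ 3)%:E))%E.
Proof.
move=> b0 k0 mf f0.
have sq0 x : - k < x < k -> 0 < k ^+ 2 - x ^+ 2.
  by move=> /andP[xk kx]; rewrite subr_sqr mulr_gt0; lra.
pose G (x : R) := b * x / Num.sqrt (k ^+ 2 - x ^+ 2).
pose h (y : R) := k * (y / Num.sqrt (b ^+ 2 + y ^+ 2)).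
pose w (x : R) := b * k ^+ 2 / Num.sqrt (k ^+ 2 - x ^+ 2) ^+ 3.
have bs y : 0 < b ^+ 2 + y ^+ 2 by rewrite ltr_wpDr ?sqr_ge0 ?exprn_gt0.
have bs0 y : 0 < Num.sqrt (b ^+ 2 + y ^+ 2) by rewrite sqrtr_gt0.
have bs2 y : Num.sqrt (b ^+ 2 + y ^+ 2) ^+ 2 = b ^+ 2 + y ^+ 2.
  by rewrite sqr_sqrtr// ltW.
have h2 y : k ^+ 2 - h y ^+ 2 = (k * b / Num.sqrt (b ^+ 2 + y ^+ 2)) ^+ 2.
  rewrite /h !exprMn !exprVn bs2; field.
  by rewrite gt_eqF.
apply: (@ge0_integral_substitution R `]- k, k[%classic G h w) => //.
- by rewrite /G; mfun.
- by rewrite /w; mfun.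
- by move=> x; rewrite /w mulr_ge0 ?mulr_ge0 ?invr_ge0 ?exprn_ge0 ?sqrtr_ge0//
    ltW.
- move=> y; rewrite /= in_itv/= -ltr_norml.
  rewrite -(@ltr_pXn2r _ 2) ?nnegrE ?normr_ge0 ?(ltW k0)//.
  rewrite real_normK ?num_real// -subr_gt0 h2 exprn_gt0//.
  by rewrite divr_gt0// mulr_gt0.
- move=> y; rewrite /G h2 sqrtr_sqr ger0_norm; last first.
    by rewrite divr_ge0 ?mulr_ge0 ?ltW.
  rewrite /h; field.
  by rewrite !gt_eqF.
- move=> x; rewrite /= in_itv/= => /sq0 x2.
  have S2 : Num.sqrt (k ^+ 2 - x ^+ 2) ^+ 2 = k ^+ 2 - x ^+ 2.
    by rewrite sqr_sqrtr// ltW.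
  have S0 : 0 < Num.sqrt (k ^+ 2 - x ^+ 2) by rewrite sqrtr_gt0.
  rewrite /h /G.
  have -> : b ^+ 2 + (b * x / Num.sqrt (k ^+ 2 - x ^+ 2)) ^+ 2 =
    (b * k / Num.sqrt (k ^+ 2 - x ^+ 2)) ^+ 2.
    rewrite !exprMn !exprVn S2; field.
    by rewrite gt_eqF.
  rewrite sqrtr_sqr ger0_norm; last by rewrite divr_ge0 ?mulr_ge0 ?ltW.
  by field; rewrite !gt_eqF.
- by move=> x y; rewrite /h ler_pM2l// sqrt_ratio_mono.
- exact: interval_is_interval.
- move=> x; rewrite /= in_itv/= => /sq0 x2.
  have S2 : Num.sqrt (k ^+ 2 - x ^+ 2) ^+ 2 = k ^+ 2 - x ^+ 2.
    by rewrite sqr_sqrtr// ltW.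
  have S0 : 0 < Num.sqrt (k ^+ 2 - x ^+ 2) by rewrite sqrtr_gt0.
  have dS : is_derive x 1 (Num.sqrt \o (fun z : R => k ^+ 2 - z ^+ 2))
      ((2 * Num.sqrt (k ^+ 2 - x ^+ 2))^-1 * (- (2 * x))).
    apply: is_derive1_comp; first exact: is_derive1_sqrt.
    by apply: is_derive_eq; rewrite /GRing.scale/=; ring.
  have dV := @is_deriveV R _ x _ 1 (lt0r_neq0 S0) dS.
  have dL : is_derive x 1 (fun z : R => b * z) b.
    by apply: is_derive_eq; rewrite /GRing.scale/=; ring.
  have dM := @is_deriveM R R^o _ _ x 1 _ _ dL dV.
  apply: is_derive_eq dM _.
  rewrite /w /GRing.scale/= /=.
  have k2 : k ^+ 2 = Num.sqrt (k ^+ 2 - x ^+ 2) ^+ 2 + x ^+ 2.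
    by rewrite S2 subrK.
  move: S0 k2; set S := Num.sqrt _ => S0 ->; field.
  by rewrite gt_eqF.
- move=> x; rewrite /= in_itv/= => /sq0 x2.
  have S0 : 0 < Num.sqrt (k ^+ 2 - x ^+ 2) by rewrite sqrtr_gt0.
  apply: cvgM; first exact: cvg_cst.
  apply: cvgV; first by rewrite expf_neq0// gt_eqF.
  apply: (@cvg_comp _ _ _ (fun z => Num.sqrt (k ^+ 2 - z ^+ 2))
    (fun z => z ^+ 3)); last exact: exprn_continuous.
  apply: (@cvg_comp _ _ _ (fun z => k ^+ 2 - z ^+ 2) (@Num.sqrt R));
    last exact: sqrt_continuous.
  apply: cvgB; first exact: cvg_cst.
  exact: exprn_continuous.
Qed.

(** The disc chart is reached one coordinate at a time. At fixed y1, the second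
coordinate x2 = y2 / sqrt (b^2 + y1^2 + y2^2) replaces y2; at fixed x2, the
first coordinate x1 replaces y1. Both steps are instances of the previous
lemma, with (b, k) equal to (sqrt (b^2 + y1^2), 1) and
(b, sqrt (1 - x2^2)). *)
Lemma ge0_integral_ball_chart (b : R) (F : R * R -> \bar R) : 0 < b ->
  measurable_fun setT F -> (forall y, 0 <= F y)%E ->
  (\int[mu]_y1 \int[mu]_y2 F (y1, y2) =
   \int[mu]_x2 \int[mu]_x1
     (F (b * x1 / Num.sqrt (1 - x1 ^+ 2 - x2 ^+ 2),
         b * x2 / Num.sqrt (1 - x1 ^+ 2 - x2 ^+ 2))%R *
      (b ^+ 2 / (1 - x1 ^+ 2 - x2 ^+ 2) ^+ 2 *
       \1_[set p : R * R | p.1 ^+ 2 + p.2 ^+ 2 < 1]%R (x1, x2))%:E))%E.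
Proof.
move=> b0 mF F0.
pose c (y : R) := Num.sqrt (b ^+ 2 + y ^+ 2).
have c0 y : 0 < c y by rewrite sqrtr_gt0 ltr_wpDr ?sqr_ge0 ?exprn_gt0.
(* the integrand after the first step, in the mixed coordinates (y1, x2) *)
pose H (p : R * R) := (F (p.1, c p.1 * p.2 / Num.sqrt (1 ^+ 2 - p.2 ^+ 2))%R *
  (c p.1 * 1 ^+ 2 / Num.sqrt (1 ^+ 2 - p.2 ^+ 2) ^+ 3 *
   \1_(`]-1, 1[%classic : set R) p.2)%:E)%E.
have mH : measurable_fun setT H.
  apply: emeasurable_funM.
    by apply: (measurableT_comp mF); rewrite /c; mfun.
  apply/measurable_EFinP; rewrite /c; mfun.
  by apply: measurableT_comp => //; exact: measurable_indic.
have H0 p : (0 <= H p)%E.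
  rewrite mule_ge0// lee_fin !mulr_ge0// ?invr_ge0 ?exprn_ge0 ?sqrtr_ge0//.
transitivity (\int[mu]_y1 \int[mu]_x2 H (y1, x2))%E.
  apply: eq_integral => y1 _.
  rewrite (@ge0_integral_sqrt_ratio (c y1) 1 (fun y2 => F (y1, y2)))//.
    rewrite integral_mkcond; apply: eq_integral => x2 _.
    rewrite patchE /H indicE/=; case: (x2 \in _); first by rewrite mulr1.
    by rewrite mulr0 mule0.
  by apply: (measurableT_comp mF); mfun.
transitivity (\int[mu]_x2 \int[mu]_y1 H (y1, x2))%E.
  exact: (@fubini_tonelli _ _ (measurableTypeR R) (measurableTypeR R) R mu mu
    H mH H0).
apply: eq_integral => x2 _.
have [x2i|x2i] := boolP (x2 \in (`]-1, 1[%classic : set R)); last first.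
  rewrite integral0_eq; last first.
    by move=> y1 _; rewrite /H /= indicE (negbTE x2i) mulr0 mule0.
  rewrite integral0_eq// => x1 _; rewrite indicE memNset ?mulr0 ?mule0//=.
  move=> x12; move: x2i; rewrite notin_setE/= in_itv/=; apply.
  by apply/andP; split; nra.
have x21 : -1 < x2 < 1 by move: x2i; rewrite inE/= in_itv.
have k20 : 0 < 1 - x2 ^+ 2 by move/andP: x21 => [? ?]; nra.
pose k := Num.sqrt (1 - x2 ^+ 2).
have k0 : 0 < k by rewrite sqrtr_gt0.
have k2 : k ^+ 2 = 1 - x2 ^+ 2 by rewrite sqr_sqrtr// ltW.
have mH2 : measurable_fun setT (fun y => H (y, x2)).
  by apply: (measurableT_comp mH); mfun.
transitivity (\int[mu]_(x1 in `](- k)%R, k[)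
  (H (b * x1 / Num.sqrt (k ^+ 2 - x1 ^+ 2), x2)%R *
      (b * k ^+ 2 / Num.sqrt (k ^+ 2 - x1 ^+ 2) ^+ 3)%:E))%E.
  exact: (@ge0_integral_sqrt_ratio b k (fun y => H (y, x2))).
rewrite integral_mkcond; apply: eq_integral => x1 _.
rewrite patchE /H !indicE x2i /= mulr1 expr1n.
have rE : (x1 \in (`](- k)%R, k[%classic : set R)) =
    ((x1, x2) \in [set p : R * R | p.1 ^+ 2 + p.2 ^+ 2 < 1]).
  apply/idP/idP; rewrite !inE/= in_itv/=.
    by move=> /andP[? ?]; nra.
  by move=> ?; apply/andP; split; nra.
rewrite -rE; case: ifPn => [|_]; last by rewrite mulr0 mule0.
rewrite inE/= in_itv/= => /andP[kx xk].
have rho2 : 0 < k ^+ 2 - x1 ^+ 2 by nra.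
have rhoE : 1 - x1 ^+ 2 - x2 ^+ 2 = k ^+ 2 - x1 ^+ 2 by rewrite k2; ring.
rewrite rhoE -/k mulr1.
pose rho := Num.sqrt (k ^+ 2 - x1 ^+ 2).
have rho0 : 0 < rho by rewrite sqrtr_gt0.
have rhoK : rho ^+ 2 = k ^+ 2 - x1 ^+ 2 by rewrite sqr_sqrtr// ltW.
rewrite -/rho -rhoK.
have -> : c (b * x1 / rho) = b * k / rho.
  rewrite /c (_ : _ + _ = (b * k / rho) ^+ 2); last first.
    have kE : k ^+ 2 = rho ^+ 2 + x1 ^+ 2 by rewrite rhoK; ring.
    by rewrite !exprMn !exprVn kE; field; rewrite gt_eqF.
  rewrite sqrtr_sqr ger0_norm// divr_ge0 ?mulr_ge0 ?ltW//.
rewrite -muleA -EFinM.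
congr (F (_, _) * _%:E)%E.
  by field; rewrite !gt_eqF.
by field; rewrite !gt_eqF.
Qed.
End projective_substitution.

Section boolean_sets.
Context d (T : measurableType d).

Lemma measurable_bool_set (b : T -> bool) :
  measurable_fun setT b -> measurable [set x | b x].
Proof.
move=> mb; have := mb measurableT [set true] I; rewrite setTI.
by congr (measurable _); apply/seteqP; split.
Qed.

End boolean_sets.

(** Measurability of a boolean combination of comparisons. *)
Ltac mbool := repeat match goal with
  | |- measurable_fun _ (fun x => @?f x && @?g x) => apply: measurable_and
  | |- measurable_fun _ (fun x => (@?f x <= @?g x)%R) =>
      apply: measurable_fun_ler; mfun
  | |- measurable_fun _ (fun x => (@?f x < @?g x)%R) =>
      apply: measurable_fun_ltr; mfun
  | |- measurable_fun _ (Order.lt ?a) =>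
      exact: (measurable_fun_ltr (measurable_cst _) (@measurable_id _ _ _))
  end.

(** * Integration over the reduced domain *)

Section density_formula.
Context {R : realType}.
Notation mu := (@lebesgue_measure R).
Notation mR := (measurableTypeR R).

Lemma ln_sqrt (x : R) : 0 < x -> ln (Num.sqrt x) = ln x / 2.
Proof.
move=> x0; rewrite -[in RHS](sqr_sqrtr (ltW x0)) lnXn ?sqrtr_gt0//.
by rewrite mulr2n; lra.
Qed.

(** The set is the segment from (L/p)^(1/4) to (1/p)^(1/4), on which ln is an
antiderivative of 1/t. *)
Lemma integral_inv_quartic (L p : R) : 0 < L <= 1 -> 0 < p ->
  (\int[mu]_t (t^-1 * \1_[set t : R |
     [&& 0 < t, L <= t ^+ 4 * p & t ^+ 4 * p <= 1]%R] t)%:E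
   = (- (ln L / 4))%:E)%E.
Proof.
move=> /andP[L0 L1] p0.
pose r (x : R) := Num.sqrt (Num.sqrt (x / p)).
have r0 x : 0 < x -> 0 < r x by move=> x0; rewrite !sqrtr_gt0 divr_gt0.
have r4 x : 0 < x -> r x ^+ 4 * p = x.
  move=> x0; rewrite (exprM _ 2 2) sqr_sqrtr ?sqrtr_ge0// sqr_sqrtr;
    last by rewrite divr_ge0 ?ltW.
  by rewrite divfK// gt_eqF.
have rle x y : 0 < x -> 0 < y -> (x <= y ^+ 4 * p) = (r x <= y).
  move=> x0 y0; rewrite -[in LHS](r4 x x0) ler_pM2r//.
  by rewrite ler_pXn2r// nnegrE ltW// r0.
have rge x y : 0 < x -> 0 < y -> (y ^+ 4 * p <= x) = (y <= r x).
  move=> x0 y0; rewrite -[in LHS](r4 x x0) ler_pM2r//.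
  by rewrite ler_pXn2r// nnegrE ltW// r0.
have lnr x : 0 < x -> ln (r x) = (ln x - ln p) / 4.
  move=> x0; rewrite ln_sqrt ?sqrtr_gt0 ?divr_gt0// ln_sqrt ?divr_gt0//.
  by rewrite ln_div ?posrE//; lra.
have rL1 : r L <= r 1 by rewrite -rle ?r4 ?r0.
transitivity (\int[mu]_(t in `[r L, r 1%R]) (t^-1)%:E)%E.
  rewrite [RHS]integral_mkcond; apply: eq_integral => t _.
  rewrite patchE indicE.
  have -> : (t \in [set t : R |
      [&& 0 < t, L <= t ^+ 4 * p & t ^+ 4 * p <= 1]]) =
    (t \in (`[r L, r 1]%classic : set R)).
    apply/idP/idP; rewrite !inE/= in_itv/=.
      by move=> /and3P[t0]; rewrite rle// rge// => -> ->.
    move=> /andP[Lt t1]; have t0 : 0 < t by apply: lt_le_trans Lt; exact: r0.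
    by rewrite t0 rle// rge// Lt.
  by case: ifPn => _; rewrite ?mulr1 ?mulr0.
have pos x : r L <= x <= r 1 -> 0 < x.
  by move=> /andP[Lx _]; apply: lt_le_trans Lx; exact: r0.
have -> := @integral_derivative R (@ln R) (fun t => t^-1) _ _ rL1
  (fun x xi => is_derive1_ln (pos x xi)) _.
  by rewrite !lnr// ln1; congr (_%:E); lra.
by move=> x xi; apply: inv_continuous; rewrite gt_eqF// pos.
Qed.

Lemma measurable_reduced_domain :
  measurable (@reduced_domain R : set (mR * mR * mR)).
Proof.
rewrite (_ : @reduced_domain R = [set v : mR * mR * mR |
   [&& (0 < v.1.1), (v.1.1 ^+ 2 <= v.1.2 ^+ 2 + v.2 ^+ 2 + 1 / v.1.1 ^+ 2),
       (2 * `|v.1.2| <= v.1.1) & (2 * `|v.2| <= v.1.1)]]).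
  by apply: measurable_bool_set; mbool.
apply/seteqP; split => -[[t y1] y2] /=.
  by move=> [-> -> -> ->].
by move=> /and4P[].
Qed.

Let leb : {sigma_finite_measure set mR -> \bar R} := @lebesgue_measure R.

Lemma sigma_finite_lebesgue2 : sigma_finite setT (lebesgue2 R).
Proof.
pose I n : set mR := `[- n%:R, n%:R]%classic.
exists (fun n => I n `*` I n).
  rewrite predeqE => -[x y]; split => // _.
  exists (Num.truncn (`|x| + `|y|)).+1 => //.
  have xy := truncnS_gt (`|x| + `|y|).
  split; rewrite /I /= in_itv/= -ler_norml (le_trans _ (ltW xy))//.
    by rewrite lerDl.
  by rewrite lerDr.
move=> n; split; first by apply: measurableX; exact: measurable_itv.
rewrite /lebesgue2/= product_measure1E; [|exact: measurable_itv..].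
change (mu (I n) * mu (I n) < +oo)%E.
have -> : mu (I n) = if (- n%:R < n%:R :> R) then (n%:R - - n%:R)%:E else 0%E.
  by rewrite lebesgue_measure_itv/= lte_fin.
case: ifPn => _; last by rewrite mule0.
by rewrite -EFinM ltry.
Qed.

(** The planar Lebesgue measure under a name of its own, to which the
sigma-finite structure is attached: below, Tonelli's theorem is applied with the
plane as one of its two factors. *)
Definition leb2_fun : set (mR * mR)%type -> \bar R := lebesgue2 R.
HB.instance Definition _ := Measure.copy leb2_fun (lebesgue2 R).
HB.instance Definition _ := Measure_isSigmaFinite.Build _ _ _ leb2_fun
  sigma_finite_lebesgue2.
Let leb2 : {sigma_finite_measure set (mR * mR)%type -> \bar R} := leb2_fun.

Lemma lebesgue3_tonelli (F : R * R * R -> \bar R) :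
  measurable_fun [set: mR * mR * mR] F -> (forall v, 0 <= F v)%E ->
  (\int[lebesgue3 R]_v F v =
   \int[mu]_t \int[mu]_y1 \int[mu]_y2 F (t, y1, y2))%E.
Proof.
move=> mF F0.
transitivity (\int[leb2]_p \int[leb]_y2 F (p, y2))%E.
  exact: (@fubini_tonelli1 _ _ (mR * mR)%type mR R leb2 leb F mF F0).
apply: (@fubini_tonelli1 _ _ mR mR R leb leb
  (fun p => \int[mu]_y2 F (p, y2))%E).
  exact: (@measurable_fun_fubini_tonelli_F _ _ (mR * mR)%type mR R leb F mF F0).
by move=> p; exact: integral_ge0.
Qed.

End density_formula.

(** * The law of (xi_R, xi_I) up to the constant *)

Section change_of_variables.
Context {R : realType}.
Notation mu := (@lebesgue_measure R).
Notation mR := (measurableTypeR R).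
Let leb : {sigma_finite_measure set mR -> \bar R} := @lebesgue_measure R.
Let leb2 : {sigma_finite_measure set (mR * mR)%type -> \bar R} := leb2_fun.

Definition xi_map (v : R * R * R) : R * R :=
  let s := Num.sqrt (v.1.2 ^+ 2 + v.2 ^+ 2 + 1 / v.1.1 ^+ 2) in
  (v.1.2 / s, v.2 / s).

Lemma measurable_xi_map :
  measurable_fun [set: mR * mR * mR] (xi_map : mR * mR * mR -> mR * mR).
Proof. by rewrite /xi_map; mfun. Qed.

Definition t_slice (L p : R) : set R :=
  [set t | [&& 0 < t, L <= t ^+ 4 * p & t ^+ 4 * p <= 1]].

Lemma max_sqE (x y : R) : max_sq x y = Num.max (x ^+ 2) (y ^+ 2).
Proof. by rewrite /max_sq !real_normK ?num_real. Qed.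

Lemma max_sq_gt0 (z : R * R) : z != (0, 0) -> 0 < max_sq z.1 z.2.
Proof.
case: z => x y /=; rewrite xpair_eqE negb_and max_sqE lt_max => /orP[] h.
  by rewrite exprn_even_gt0//= h.
by rewrite orbC exprn_even_gt0//= h.
Qed.

Lemma max_sq_norm (x y : R) :
  max_sq x y <= 1 / 4 -> 1 / 2 <= 1 - x ^+ 2 - y ^+ 2.
Proof. by rewrite max_sqE ge_max => /andP[? ?]; lra. Qed.

(** In the disc chart |y|^2 + 1/t^2 equals 1 / (t rho)^2. The three inequalities
of the reduced domain compare t and t rho with it and with the coordinates, and
become bounds on t^4 rho^2. *)
Lemma reduced_domain_chart (t x1 x2 : R) : 0 < t -> x1 ^+ 2 + x2 ^+ 2 < 1 ->
  let rho := Num.sqrt (1 - x1 ^+ 2 - x2 ^+ 2) in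
  let v := (t, t^-1 * x1 / rho, t^-1 * x2 / rho) in
  xi_map v = (x1, x2) /\
  (reduced_domain v <->
   t_slice (4 * max_sq x1 x2) (1 - x1 ^+ 2 - x2 ^+ 2) t).
Proof.
move=> t0 x12 rho v.
have p0 : 0 < 1 - x1 ^+ 2 - x2 ^+ 2 by lra.
have rho0 : 0 < rho by rewrite sqrtr_gt0.
have rho2 : rho ^+ 2 = 1 - x1 ^+ 2 - x2 ^+ 2 by rewrite sqr_sqrtr// ltW.
have x2E : x2 ^+ 2 = 1 - x1 ^+ 2 - rho ^+ 2 by rewrite rho2; ring.
have sE : (t^-1 * x1 / rho) ^+ 2 + (t^-1 * x2 / rho) ^+ 2 + 1 / t ^+ 2 =
    (t * rho) ^- 2.
  rewrite !exprMn x2E !exprVn; field.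
  by rewrite !gt_eqF.
have trho0 : 0 < t * rho by rewrite mulr_gt0.
split.
  rewrite /xi_map /v /= sE sqrtrV ?exprn_ge0 ?(ltW trho0)// sqrtr_sqr.
  rewrite gtr0_norm//.
  by congr (_, _); field; rewrite !gt_eqF.
have t40 : 0 < t ^+ 4 by rewrite exprn_gt0.
have norm_cond (x : R) : (2 * `|t^-1 * x / rho| <= t) =
    (4 * x ^+ 2 <= t ^+ 4 * (1 - x1 ^+ 2 - x2 ^+ 2)).
  rewrite -rho2 !normrM !normfV (gtr0_norm t0) (gtr0_norm rho0).
  rewrite mulrA ler_pdivrMr// mulrCA mulrC ler_pdivrMr//.
  rewrite -(@ler_pXn2r _ 2) ?nnegrE ?mulr_ge0 ?(ltW t0) ?(ltW rho0)//.
  rewrite exprMn real_normK ?num_real//; congr (_ <= _); ring.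
rewrite /reduced_domain /v /= sE !norm_cond /t_slice /= max_sqE maxr_pMr//.
rewrite ge_max t0 -rho2.
have -> : (t ^+ 2 <= (t * rho) ^- 2) = (t ^+ 4 * rho ^+ 2 <= 1).
  rewrite -[_ ^- 2]mul1r ler_pdivlMr ?exprn_gt0//; congr (_ <= _); ring.
by split => [[_ -> -> ->]|/= /andP[/andP[-> ->] ->]].
Qed.

Lemma measurable_t_slice d (T : measurableType d) (t L p : T -> R) :
  measurable_fun setT t -> measurable_fun setT L -> measurable_fun setT p ->
  measurable [set x | t_slice (L x) (p x) (t x)].
Proof. by move=> mt mL mp; apply: measurable_bool_set; mbool. Qed.

Variables (c : R) (A : set (mR * mR)).
Hypotheses (c0 : 0 <= c) (mA : measurable A).

(* [Q], [M] and [K] are the integrand in the original coordinates, in the disc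
   chart, and after integration over t. *)
Let Q (v : R * R * R) : \bar R :=
  (c * v.1.1 * \1_(@reduced_domain R) v * \1_A (xi_map v))%:E.

Let M (q : R * (R * R)) : \bar R :=
  (c * (q.1^-1 * \1_[set q : R * (R * R) |
     t_slice (4 * max_sq q.2.1 q.2.2) (1 - q.2.1 ^+ 2 - q.2.2 ^+ 2) q.1] q) *
   ((1 - q.2.1 ^+ 2 - q.2.2 ^+ 2) ^- 2 *
    \1_[set p : R * R | p.1 ^+ 2 + p.2 ^+ 2 < 1] q.2 * \1_A q.2))%:E.

Let K (z : R * R) : \bar R :=
  (c * (- ln (4 * max_sq z.1 z.2) / (4 * (1 - z.1 ^+ 2 - z.2 ^+ 2) ^+ 2)) *
   \1_[set p : R * R | max_sq p.1 p.2 <= 1 / 4] z * \1_A z)%:E.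

Let mQ : measurable_fun [set: mR * mR * mR] Q.
Proof.
apply/measurable_EFinP; apply: measurable_funM; last first.
  by apply: (measurableT_comp (measurable_indic mA)); exact: measurable_xi_map.
apply: measurable_funM; first by mfun.
by apply: measurable_indic; exact: measurable_reduced_domain.
Qed.

Let Q0 v : (0 <= Q v)%E.
Proof.
rewrite /Q lee_fin mulr_ge0// indicE.
have [vD|_] := boolP (v \in _); last by rewrite mulr0.
rewrite !mulr_ge0//; move: vD; rewrite inE.
by case: v => -[t y1] y2 [/ltW].
Qed.

Let mM : measurable_fun [set: mR * (mR * mR)] M.
Proof.
apply/measurable_EFinP; apply: measurable_funM.
  apply: measurable_funM; first by mfun.
  apply: measurable_funM; first by mfun.
  apply: measurable_indic; apply: (@measurable_t_slice _ (mR * (mR * mR))%type).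
  - by mfun.
  - by rewrite /max_sq; mfun.
  - by mfun.
apply: measurable_funM; last first.
  by apply: (measurableT_comp (measurable_indic mA)); mfun.
apply: measurable_funM; first by mfun.
apply: measurableT_comp; last by mfun.
by apply: measurable_indic; apply: measurable_bool_set; mbool.
Qed.

Let M0 q : (0 <= M q)%E.
Proof.
rewrite /M lee_fin; apply: mulr_ge0; last first.
  by rewrite !mulr_ge0// invr_ge0 sqr_ge0.
rewrite mulr_ge0// indicE.
have [|_] := boolP (q \in _); last by rewrite mulr0.
by rewrite inE /t_slice /= => /and3P[/ltW ? _ _]; rewrite mulr_ge0// invr_ge0.
Qed.

Let K0 z : (0 <= K z)%E.
Proof.
rewrite /K lee_fin mulr_ge0// indicE.
have [|_] := boolP (z \in _); last by rewrite mulr0.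
rewrite inE /= => m1; rewrite mulr1 mulr_ge0// divr_ge0//.
  rewrite oppr_ge0 ln_le0//; lra.
by rewrite mulr_ge0// sqr_ge0.
Qed.

Let mK : measurable_fun [set: mR * mR] K.
Proof.
apply/measurable_EFinP; apply: measurable_funM; last exact: measurable_indic.
apply: measurable_funM; first by rewrite /max_sq; mfun.
by apply: measurable_indic; apply: measurable_bool_set; rewrite /max_sq; mbool.
Qed.

Let integral_slice (t : R) :
  (\int[leb]_y1 \int[leb]_y2 Q (t, y1, y2) = \int[leb2]_z M (t, z))%E.
Proof.
have [t0|t0] := ltP 0 t; last first.
  rewrite integral0_eq; last first.
    move=> y1 _; rewrite integral0_eq// => y2 _.
    rewrite /Q indicE memNset ?mulr0 ?mul0r// => -[].
    by rewrite ltNge t0.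
  rewrite integral0_eq// => z _; rewrite /M indicE memNset ?mulr0 ?mul0r//.
  by rewrite /t_slice /= ltNge t0.
have t'0 : 0 < t^-1 by rewrite invr_gt0.
have mQt : measurable_fun [set: mR * mR] (fun y => Q (t, y.1, y.2)).
  by apply: (measurableT_comp mQ); mfun.
have := ge0_integral_ball_chart t'0 mQt (fun y => Q0 _) => /= ->.
transitivity (\int[leb]_x2 \int[leb]_x1 M (t, (x1, x2)))%E; last first.
  apply/esym; apply: (@fubini_tonelli2 _ _ mR mR R leb leb (fun z => M (t, z))).
    by apply: (measurableT_comp mM); mfun.
  by move=> z; exact: M0.
apply: eq_integral => x2 _; apply: eq_integral => x1 _.
rewrite /M /Q /= -EFinM; congr EFin.
have [/set_mem/= x12|x12] := boolP ((x1, x2) \in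
  [set p : R * R | p.1 ^+ 2 + p.2 ^+ 2 < 1]); last first.
  by rewrite !indicE (negbTE x12) !(mulr0, mul0r).
have [XE DE] := reduced_domain_chart t0 x12.
rewrite XE [in LHS]indicE.
have -> : ((t, t^-1 * x1 / Num.sqrt (1 - x1 ^+ 2 - x2 ^+ 2),
         t^-1 * x2 / Num.sqrt (1 - x1 ^+ 2 - x2 ^+ 2)) \in @reduced_domain R) =
   ((t, (x1, x2)) \in [set q : R * (R * R) |
     t_slice (4 * max_sq q.2.1 q.2.2) (1 - q.2.1 ^+ 2 - q.2.2 ^+ 2) q.1]).
  by apply/idP/idP; rewrite !inE => /DE.
rewrite -indicE; set I := \1__ _; set p := 1 - _ - _.
have p0 : p != 0 by rewrite gt_eqF// /p; lra.
by field; rewrite p0 gt_eqF.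
Qed.

Let integral_fiber (z : R * R) : z != (0, 0) -> (\int[leb]_t M (t, z) = K z)%E.
Proof.
move=> z0; have m0 := max_sq_gt0 z0.
set p := 1 - z.1 ^+ 2 - z.2 ^+ 2.
set L := 4 * max_sq z.1 z.2.
have L0 : 0 < L by rewrite mulr_gt0.
have [m1|m1] := leP (max_sq z.1 z.2) (1 / 4); last first.
  rewrite integral0_eq.
    by rewrite /K indicE memNset ?mulr0 ?mul0r//= leNgt m1.
  move=> t _; rewrite /M [X in _ * (_ * X) * _]indicE memNset ?mulr0 ?mul0r//.
  rewrite /t_slice /= => /and3P[_ Lt t1].
  by have := le_trans Lt t1; lra.
have p0 : 0 < p by have := max_sq_norm m1; rewrite /p; lra.
have L1 : 0 < L <= 1 by rewrite L0/= /L; lra.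
pose k := c * (p ^- 2 * \1_A z).
transitivity (\int[leb]_t (k%:E * (t^-1 * \1_[set t : R |
    [&& 0 < t, L <= t ^+ 4 * p & t ^+ 4 * p <= 1]%R] t)%:E))%E.
  apply: eq_integral => t _; rewrite /M -EFinM; congr EFin.
  rewrite [X in _ * (_ * X * _) = _]indicE mem_set; last first.
    by move: p0; rewrite /p /=; lra.
  rewrite [X in _ * (_ * X) * _ = _]indicE [X in _ = _ * (_ * X)]indicE.
  rewrite /k.
  have -> : ((t, z) \in [set q : R * (R * R) |
     t_slice (4 * max_sq q.2.1 q.2.2) (1 - q.2.1 ^+ 2 - q.2.2 ^+ 2) q.1]) =
   (t \in [set t : R | [&& 0 < t, L <= t ^+ 4 * p & t ^+ 4 * p <= 1]%R]).
    by apply/idP/idP; rewrite !inE.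
  by rewrite /= -/p mulr1; ring.
rewrite ge0_integralZl//; last 3 first.
- apply/measurable_EFinP; apply: measurable_funM; first exact: measurable_invr.
  by apply: measurable_indic; apply: measurable_bool_set; mbool.
- move=> t _; rewrite lee_fin indicE; have [|_] := boolP (t \in _).
    by rewrite inE /= => /and3P[/ltW ? _ _]; rewrite mulr1 invr_ge0.
  by rewrite mulr0.
- by rewrite lee_fin /k !mulr_ge0// invr_ge0 sqr_ge0.
have := integral_inv_quartic L1 p0 => ->.
rewrite /K -EFinM; congr EFin; rewrite [X in _ = _ * X * _]indicE mem_set//=.
rewrite /k -/L -/p; set I := \1_A z.
by field; rewrite gt_eqF.
Qed.

(** The chart is used at fixed t, then t is integrated first. The integral
over t gives the density everywhere but at the origin, where it diverges while
[ln 0 = 0]; the origin is a null set. *)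
Lemma integral_xi_map :
  (\int[lebesgue3 R]_v Q v = \int[lebesgue2 R]_z K z)%E.
Proof.
transitivity (\int[leb]_t \int[leb]_y1 \int[leb]_y2 Q (t, y1, y2))%E.
  exact: lebesgue3_tonelli.
transitivity (\int[leb]_t \int[leb2]_z M (t, z))%E.
  by apply: eq_integral => t _; exact: integral_slice.
transitivity (\int[leb2]_z \int[leb]_t M (t, z))%E.
  exact: (@fubini_tonelli _ _ mR (mR * mR)%type R leb leb2 M mM M0).
apply: ge0_ae_eq_integral => //.
- exact: (@measurable_fun_fubini_tonelli_G _ _ mR (mR * mR)%type R leb M mM M0).
- by move=> z _; exact: integral_ge0.
- exists [set (0, 0)]; split.
  + rewrite (_ : [set (0, 0)] = [set 0] `*` [set 0]).
      exact: measurableX.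
    by apply/seteqP; split => -[x y] /=; [move=> [-> ->]|move=> [-> ->]].
  + rewrite (_ : [set (0, 0)] = [set 0] `*` [set 0]); last first.
      by apply/seteqP; split => -[x y] /=; [move=> [-> ->]|move=> [-> ->]].
    transitivity (mu [set 0%R] * mu [set 0%R])%E.
      exact: (@product_measure1E _ _ mR mR R leb leb).
    by rewrite lebesgue_measure_set1 mul0e.
  + move=> z /=; apply: contra_notP => /eqP z0 _; exact: integral_fiber.
Qed.

End change_of_variables.

(** * The total mass as an integral over a square *)

Section total_mass.
Context {R : realType}.
Notation mu := (@lebesgue_measure R).
Notation mR := (measurableTypeR R).
Let leb : {sigma_finite_measure set mR -> \bar R} := @lebesgue_measure R.
Let leb2 : {sigma_finite_measure set (mR * mR)%type -> \bar R} := leb2_fun.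

Lemma ge0_integral_dilation (k : R) (f : R -> \bar R) : 0 < k ->
  measurable_fun setT f -> (forall y, 0 <= f y)%E ->
  (\int[mu]_y f y = \int[mu]_x (f (k * x)%R * k%:E))%E.
Proof.
move=> k0 mf f0.
apply: (@ge0_integral_substitution R setT (fun x => k * x) (fun y => k^-1 * y)
  (cst k)) => //.
- by mfun.
- by move=> x; rewrite /= ltW.
- by move=> y; rewrite mulrA mulfV ?mul1r// gt_eqF.
- by move=> y _; rewrite mulrA mulVf ?mul1r// gt_eqF.
- by move=> x y; rewrite ler_pM2l// invr_gt0.
- move=> x _; have := is_deriveZ (f := @id R) (x := x) (v := 1) k.
  by move=> /(_ 1); rewrite /GRing.scale/= mulr1; apply.
- by move=> x _; exact: cvg_cst.
Qed.

Lemma integral_cube_quartic (p : R) : 0 < p ->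
  (\int[mu]_t (t ^+ 3 / 4 *
     \1_[set t : R | (0 < t) && (t ^+ 4 * p <= 1)]%R t)%:E
   = ((16 * p)^-1)%:E)%E.
Proof.
move=> p0.
pose r : R := Num.sqrt (Num.sqrt p^-1).
have r0 : 0 < r by rewrite !sqrtr_gt0 invr_gt0.
have r4 : r ^+ 4 = p^-1.
  by rewrite (exprM _ 2 2) sqr_sqrtr ?sqrtr_ge0// sqr_sqrtr// invr_ge0 ltW.
transitivity (\int[mu]_(t in `[0%R, r]) (t ^+ 3 / 4)%:E)%E.
  rewrite [RHS]integral_mkcond; apply: eq_integral => t _.
  rewrite patchE indicE.
  have [->|t0] := eqVneq t 0.
    by rewrite expr0n/= !mul0r if_same.
  have -> : (t \in [set t : R | (0 < t) && (t ^+ 4 * p <= 1)]) =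
    (t \in (`[0, r]%classic : set R)).
    apply/idP/idP; rewrite !inE/= in_itv/= lt_neqAle eq_sym t0/= => /andP[t1].
      rewrite t1 -ler_pdivlMr// mul1r -r4 ler_pXn2r// nnegrE ltW//.
    by move=> tr; rewrite t1 -ler_pdivlMr// mul1r -r4 ler_pXn2r// nnegrE ltW.
  by case: ifPn => _; rewrite ?mulr1 ?mulr0.
have dF (x : R) : is_derive x 1 (fun t => t ^+ 4 / 16) (x ^+ 3 / 4).
  by apply: is_derive_eq; rewrite /GRing.scale/=; lra.
have cF (x : R) : {for x, continuous (fun t : R => t ^+ 3 / 4)}.
  by apply: cvgM; [exact: exprn_continuous|exact: cvg_cst].
rewrite (integral_derivative (ltW r0) (fun x _ => dF x) (fun x _ => cF x)).
by rewrite r4 expr0n/= mul0r subr0 invfM mulrC.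
Qed.

(* [q], [N] and [h] are the integrand in the original coordinates, in the
   coordinates (t, a, b), and after integration over t. *)
Let q (v : R * R * R) : \bar R := (v.1.1 * \1_(@reduced_domain R) v)%:E.

Let N (u : R * (R * R)) : \bar R :=
  (u.1 ^+ 3 / 4 * \1_[set u : R * (R * R) | [&& 0 < u.1,
     u.1 ^+ 4 * ((4 - u.2.1 ^+ 2 - u.2.2 ^+ 2) / 4) <= 1,
     `|u.2.1| <= 1 & `|u.2.2| <= 1]] u)%:E.

Let h (z : R * R) : \bar R :=
  ((4 * (4 - z.1 ^+ 2 - z.2 ^+ 2))^-1 *
   \1_[set z : R * R | (`|z.1| <= 1) && (`|z.2| <= 1)] z)%:E.

Let mq : measurable_fun [set: mR * mR * mR] q.
Proof.
apply/measurable_EFinP; apply: measurable_funM; first by mfun.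
by apply: measurable_indic; exact: measurable_reduced_domain.
Qed.

Let q0 v : (0 <= q v)%E.
Proof.
rewrite /q lee_fin indicE.
have [vD|_] := boolP (v \in _); last by rewrite mulr0.
rewrite !mulr_ge0//; move: vD; rewrite inE.
by case: v => -[t y1] y2 [/ltW].
Qed.

Let mN : measurable_fun [set: mR * (mR * mR)] N.
Proof.
apply/measurable_EFinP; apply: measurable_funM; first by mfun.
by apply: measurable_indic; apply: measurable_bool_set; mbool.
Qed.

Let N0 u : (0 <= N u)%E.
Proof.
rewrite /N lee_fin indicE.
have [|_] := boolP (u \in _); last by rewrite mulr0.
rewrite inE /= => /and4P[/ltW u0 _ _ _].
by rewrite mulr1 divr_ge0// exprn_ge0.
Qed.

Let mh : measurable_fun [set: mR * mR] h.
Proof.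
apply/measurable_EFinP; apply: measurable_funM; first by mfun.
by apply: measurable_indic; apply: measurable_bool_set; mbool.
Qed.

Lemma norm_le1_sqr (x : R) : `|x| <= 1 -> x ^+ 2 <= 1.
Proof. by rewrite -real_normK ?num_real// => x1; rewrite exprn_ile1. Qed.

Let h0 z : (0 <= h z)%E.
Proof.
rewrite /h lee_fin indicE.
have [|_] := boolP (z \in _); last by rewrite mulr0.
rewrite inE /= => /andP[/norm_le1_sqr ? /norm_le1_sqr ?].
by rewrite mulr1 invr_ge0; lra.
Qed.

Let mass_slice (t : R) :
  (\int[leb]_y1 \int[leb]_y2 q (t, y1, y2) = \int[leb2]_z N (t, z))%E.
Proof.
have [t0|t0] := ltP 0 t; last first.
  rewrite integral0_eq; last first.
    move=> y1 _; rewrite integral0_eq// => y2 _.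
    rewrite /q indicE memNset ?mulr0 ?mul0r// => -[].
    by rewrite ltNge t0.
  rewrite integral0_eq// => z _; rewrite /N indicE memNset ?mulr0 ?mul0r//.
  by rewrite /= ltNge t0.
have t20 : 0 < t / 2 by rewrite divr_gt0.
transitivity (\int[leb]_a \int[leb]_b N (t, (a, b)))%E; last first.
  apply/esym; apply: (@fubini_tonelli1 _ _ mR mR R leb leb (fun z => N (t, z))).
    by apply: (measurableT_comp mN); mfun.
  by move=> z; exact: N0.
have mqt : measurable_fun [set: mR * mR] (fun y => q (t, y.1, y.2)).
  by apply: (measurableT_comp mq); mfun.
have mqi : measurable_fun [set: mR] (fun y1 => \int[leb]_y2 q (t, y1, y2))%E.
  exact: (@measurable_fun_fubini_tonelli_F _ _ mR mR R leb _ mqt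
    (fun y => q0 _)).
rewrite (ge0_integral_dilation t20 mqi); last by move=> y; exact: integral_ge0.
apply: eq_integral => a _.
have mqa (y : R) : measurable_fun [set: mR] (fun y2 => q (t, y, y2)).
  by apply: (measurableT_comp mq); mfun.
rewrite (ge0_integral_dilation t20 (mqa _))//.
rewrite -ge0_integralZr//.
- apply: eq_integral => b _; rewrite /q /N -!EFinM; congr EFin => /=.
  rewrite !indicE.
  have -> : ((t, t / 2 * a, t / 2 * b) \in @reduced_domain R) =
    ((t, (a, b)) \in [set u : R * (R * R) | [&& 0 < u.1,
     u.1 ^+ 4 * ((4 - u.2.1 ^+ 2 - u.2.2 ^+ 2) / 4) <= 1,
     `|u.2.1| <= 1 & `|u.2.2| <= 1]]).
    have nE (x : R) : (2 * `|t / 2 * x| <= t) = (`|x| <= 1).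
      rewrite normrM (gtr0_norm t20) (_ : 2 * _ = t * `|x|); last by field.
      by rewrite ger_pMr.
    have tE : (t ^+ 2 <= (t / 2 * a) ^+ 2 + (t / 2 * b) ^+ 2 + 1 / t ^+ 2) =
      (t ^+ 4 * ((4 - a ^+ 2 - b ^+ 2) / 4) <= 1).
      rewrite -lerBlDl ler_pdivlMr ?exprn_gt0//; congr (_ <= _).
      by field.
    have DE : reduced_domain (t, t / 2 * a, t / 2 * b) <->
      [&& 0 < t, t ^+ 4 * ((4 - a ^+ 2 - b ^+ 2) / 4) <= 1,
          `|a| <= 1 & `|b| <= 1].
      rewrite /reduced_domain /= !nE tE t0.
      by split => [[_ -> -> ->]|/= /and3P[]].
    by apply/idP/idP => /set_mem/DE ?; exact/mem_set.
  by rewrite [X in X * _ = _]mulrAC [LHS]mulrAC; congr (_ * _); field.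
- by apply: emeasurable_funM => //; apply: (measurableT_comp (mqa _)); mfun.
- by move=> b _; rewrite mule_ge0// lee_fin ltW.
- by rewrite lee_fin ltW.
Qed.

Let mass_fiber (z : R * R) : (\int[leb]_t N (t, z) = h z)%E.
Proof.
have [z1|z1] := boolP ((`|z.1| <= 1) && (`|z.2| <= 1)); last first.
  rewrite integral0_eq.
    by rewrite /h indicE memNset ?mulr0//=; exact/negP.
  move=> t _; rewrite /N indicE memNset ?mulr0 ?mul0r//=.
  by move=> /and4P[_ _ za zb]; move: z1; rewrite za zb.
have [/norm_le1_sqr z1' /norm_le1_sqr z2'] := andP z1.
have p0 : 0 < (4 - z.1 ^+ 2 - z.2 ^+ 2) / 4 by lra.
rewrite /h indicE mem_set// mulr1.
rewrite (_ : 4 * _ = 16 * ((4 - z.1 ^+ 2 - z.2 ^+ 2) / 4)); last by field.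
rewrite -integral_cube_quartic//; apply: eq_integral => t _; rewrite /N !indicE.
congr ((_ * (nat_of_bool _)%:R)%:E).
by apply/idP/idP; rewrite !inE/= ?z1 ?andbT.
Qed.

(** In the coordinates y_i = t a_i / 2 the conditions on the y_i become those of
a fixed square, and the remaining one bounds t^4 by 4 / (4 - a^2 - b^2). The
density t and the Jacobian t^2 / 4 then give an elementary integral over t. *)
Lemma mass_square :
  (\int[lebesgue3 R]_v q v = \int[leb]_a \int[leb]_b h (a, b))%E.
Proof.
transitivity (\int[leb]_t \int[leb]_y1 \int[leb]_y2 q (t, y1, y2))%E.
  exact: lebesgue3_tonelli.
transitivity (\int[leb]_t \int[leb2]_z N (t, z))%E.
  by apply: eq_integral => t _; exact: mass_slice.
transitivity (\int[leb2]_z \int[leb]_t N (t, z))%E.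
  exact: (@fubini_tonelli _ _ mR (mR * mR)%type R leb leb2 N mN N0).
transitivity (\int[leb2]_z h z)%E.
  by apply: eq_integral => z _; exact: mass_fiber.
exact: (@fubini_tonelli1 _ _ mR mR R leb leb h mh h0).
Qed.

End total_mass.

(** * From the square to a segment *)

Section catalan_integral.
Context {R : realType}.
Notation mu := (@lebesgue_measure R).
Notation mR := (measurableTypeR R).

Lemma is_derive_ln_comp (f : R -> R) (x df : R) : 0 < f x ->
  is_derive x 1 f df -> is_derive x 1 (fun z => ln (f z)) ((f x)^-1 * df).
Proof.
by move=> f0 dF; apply: (is_derive1_comp (f := @ln R)); exact: is_derive1_ln.
Qed.

Lemma is_derive_atan_comp (f : R -> R) (x df : R) :
  is_derive x 1 f df ->
  is_derive x 1 (fun z => atan (f z)) ((1 + f x ^+ 2)^-1 * df).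
Proof.
by move=> dF; apply: (is_derive1_comp (f := @atan R)); exact: is_derive1_atan.
Qed.

Lemma is_derive_div (f g : R -> R) (x df dg : R) : g x != 0 ->
  is_derive x 1 f df -> is_derive x 1 g dg ->
  is_derive x 1 (fun z => f z / g z) ((df * g x - f x * dg) / g x ^+ 2).
Proof.
move=> g0 dF dG; have dV := @is_deriveV R g x dg 1 g0 dG.
apply: is_derive_eq (@is_deriveM R R^o f _ x 1 _ _ dF dV) _.
by rewrite /GRing.scale/=; field.
Qed.

(** Four times the integral of 1 / (4 (4 - x^2 - b^2)) over |b| <= x, by partial
fractions. *)
Definition log_slice (x : R) : R :=
  let d := Num.sqrt (4 - x ^+ 2) in (ln (d + x) - ln (d - x)) / d.

Lemma sqrt4B (x : R) : 0 <= x <= 1 ->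
  let d := Num.sqrt (4 - x ^+ 2) in
  [/\ d ^+ 2 = 4 - x ^+ 2, 0 < d & x < d].
Proof.
move=> /andP[x0 x1] d.
have d2 : d ^+ 2 = 4 - x ^+ 2 by rewrite sqr_sqrtr//; nra.
have d0 : 0 < d by rewrite sqrtr_gt0; nra.
by split => //; nra.
Qed.

Lemma log_slice_ge0 (x : R) : 0 <= x <= 1 -> 0 <= log_slice x.
Proof.
move=> x01; have [d2 d0 xd] := sqrt4B x01; rewrite /log_slice.
rewrite divr_ge0 ?(ltW d0)//.
move/andP: x01 => [x0 x1].
by rewrite subr_ge0 ler_ln ?posrE; lra.
Qed.

Lemma integral_segment (a : R) : 0 <= a <= 1 ->
  (\int[mu]_(b in `[(- a)%R, a]) ((4 * (4 - a ^+ 2 - b ^+ 2))^-1)%:E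
   = (log_slice a / 4)%:E)%E.
Proof.
move=> a01; have [d2 d0 ad] := sqrt4B a01; move/andP: (a01) => [a0 a1].
set d := Num.sqrt _ in d2 d0 ad.
pose F (b : R) := (ln (d + b) - ln (d - b)) * (8 * d)^-1.
have dF (b : R) : - a <= b <= a ->
    is_derive b 1 F ((4 * (4 - a ^+ 2 - b ^+ 2))^-1).
  move=> /andP[b0 b1].
  have d1 : is_derive b 1 (fun z => ln (d + z)) ((d + b)^-1 * 1).
    apply: is_derive_ln_comp; first lra.
    by apply: is_derive_eq; rewrite add0r.
  have d3 : is_derive b 1 (fun z => ln (d - z)) ((d - b)^-1 * -1).
    apply: is_derive_ln_comp; first lra.
    by apply: is_derive_eq; ring.
  have dB := is_deriveB d1 d3.
  have dk : is_derive b 1 (fun _ : R => (8 * d)^-1) 0 by exact: is_derive_cst.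
  apply: is_derive_eq (@is_deriveM R R^o _ _ b 1 _ _ dB dk) _.
  rewrite /GRing.scale/= -d2; field.
  by apply/and4P; split; rewrite ?subr_sqr ?mulf_neq0 ?gt_eqF//; lra.
have cF (b : R) : - a <= b <= a ->
    {for b, continuous (fun z : R => (4 * (4 - a ^+ 2 - z ^+ 2))^-1)}.
  move=> /andP[b0 b1].
  apply: cvgV; first by rewrite gt_eqF//; nra.
  apply: cvgM; first exact: cvg_cst.
  by apply: cvgB; [exact: cvg_cst|exact: exprn_continuous].
have aa : - a <= a by lra.
rewrite (integral_derivative aa dF cF); congr EFin.
rewrite /F /log_slice -/d opprK; field.
by rewrite gt_eqF.
Qed.

End catalan_integral.

Section square.
Context {R : realType}.
Notation mu := (@lebesgue_measure R).
Notation mR := (measurableTypeR R).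
Let leb : {sigma_finite_measure set mR -> \bar R} := @lebesgue_measure R.

Lemma ge0_integral_even (f : R -> \bar R) : measurable_fun [set: R] f ->
  (forall x, 0 <= f x)%E -> (forall x, f (- x)%R = f x) ->
  (\int[mu]_x f x =
   \int[mu]_(x in `[0%R, +oo[) f x + \int[mu]_(x in `[0%R, +oo[) f x)%E.
Proof.
move=> mf f0 fN.
have neg : (\int[mu]_(x in `]-oo, 0%R]) f x =
    \int[mu]_(x in `[0%R, +oo[) f x)%E.
  rewrite (ge0_integration_by_substitution0 mf f0).
  by apply: eq_integral => x _; rewrite fN.
rewrite -[X in _ = (X + _)%E]neg -[X in _ = (_ + X)%E]integral_itv_obnd_cbnd;
  last exact: measurable_funTS.
rewrite -set_itvNyy (@itv_bndbnd_setU _ _ -oo%O (BRight 0%R) +oo%O)//.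
rewrite ge0_integral_setU//.
- by rewrite -itv_bndbnd_setU// set_itvNyy.
- apply/disj_setPS => x [] /=; rewrite !in_itv/= andbT => x0 x0'.
  by move: (lt_le_trans x0' x0); rewrite ltxx.
Qed.

Definition square_density (z : R * R) : R :=
  (4 * (4 - z.1 ^+ 2 - z.2 ^+ 2))^-1 *
   \1_[set z : R * R | (`|z.1| <= 1) && (`|z.2| <= 1)] z.

Let e (x : R) : \bar R :=
  (log_slice `|x| / 4 * \1_[set x : R | `|x| <= 1] x)%:E.

Let me : measurable_fun [set: mR] e.
Proof.
apply/measurable_EFinP; apply: measurable_funM.
  by rewrite /log_slice; mfun.
by apply: measurable_indic; apply: measurable_bool_set; mbool.
Qed.

Let e0 x : (0 <= e x)%E.
Proof.
rewrite /e lee_fin indicE; have [|_] := boolP (x \in _); last by rewrite mulr0.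
by rewrite inE/= => x1; rewrite mulr1 divr_ge0// log_slice_ge0// normr_ge0.
Qed.

Let msq : measurable_fun [set: mR * mR] square_density.
Proof.
apply: measurable_funM; first by mfun.
by apply: measurable_indic; apply: measurable_bool_set; mbool.
Qed.

Lemma square_density_ge0 z : 0 <= square_density z.
Proof.
rewrite /square_density indicE.
have [|_] := boolP (z \in _); last by rewrite mulr0.
rewrite inE /= => /andP[/norm_le1_sqr ? /norm_le1_sqr ?].
by rewrite mulr1 invr_ge0; lra.
Qed.

Lemma square_densityC a b : square_density (a, b) = square_density (b, a).
Proof.
rewrite /square_density !indicE/=; congr (_^-1 * (nat_of_bool _)%:R).
  by ring.
by apply/idP/idP; rewrite !inE/= andbC.
Qed.

Let square_triangle (x : R) :
  (\int[mu]_(b in `[(- `|x|)%R, `|x|%R]) (square_density (x, b))%:E = e x)%E.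
Proof.
have [x1|x1] := leP `|x| 1; last first.
  rewrite integral0_eq; last first.
    move=> b _; rewrite /square_density indicE memNset ?mulr0//=.
    by rewrite leNgt x1.
  by rewrite /e indicE memNset ?mulr0//=; rewrite leNgt x1.
rewrite /e indicE mem_set// mulr1 -integral_segment ?normr_ge0//.
apply: eq_integral => b; rewrite inE/= in_itv/= -ler_norml => bx.
rewrite /square_density indicE mem_set/= ?x1 ?(le_trans bx)// mulr1.
by rewrite real_normK ?num_real.
Qed.

Let square_open_triangle (x : R) :
  (\int[mu]_(b in `](- `|x|)%R, `|x|%R[) (square_density (x, b))%:E = e x)%E.
Proof.
rewrite -square_triangle [RHS]integral_itv_bndoo//.
apply: measurable_funTS; apply/measurable_EFinP.
by apply: (measurableT_comp msq); mfun.
Qed.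

(** The triangles |b| <= |a| and |a| < |b| are exchanged by the symmetry of the
integrand, and the integral over each slice of a triangle is elementary. The
result is even in the remaining variable. *)
Lemma integral_square_density :
  (\int[mu]_a \int[mu]_b (square_density (a, b))%:E =
   \int[mu]_(x in `[0%R, 1%R]) (log_slice x)%:E)%E.
Proof.
pose h1 (z : R * R) : \bar R :=
  (square_density z * \1_[set z : R * R | `|z.2| <= `|z.1|] z)%:E.
pose h2 (z : R * R) : \bar R :=
  (square_density z * \1_[set z : R * R | `|z.1| < `|z.2|] z)%:E.
have mh1 : measurable_fun [set: mR * mR] h1.
  apply/measurable_EFinP; apply: measurable_funM => //.
  by apply: measurable_indic; apply: measurable_bool_set; mbool.
have mh2 : measurable_fun [set: mR * mR] h2.
  apply/measurable_EFinP; apply: measurable_funM => //.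
  by apply: measurable_indic; apply: measurable_bool_set; mbool.
have h10 z : (0 <= h1 z)%E by rewrite lee_fin mulr_ge0// square_density_ge0.
have h20 z : (0 <= h2 z)%E by rewrite lee_fin mulr_ge0// square_density_ge0.
have mh1a (a : R) : measurable_fun [set: mR] (fun b => h1 (a, b)).
  by apply: (measurableT_comp mh1); mfun.
have mh2a (a : R) : measurable_fun [set: mR] (fun b => h2 (a, b)).
  by apply: (measurableT_comp mh2); mfun.
transitivity (\int[mu]_a (\int[mu]_b h1 (a, b) + \int[mu]_b h2 (a, b)))%E.
  apply: eq_integral => a _; rewrite -ge0_integralD//.
  apply: eq_integral => b _; rewrite /h1 /h2 -EFinD -mulrDr; congr EFin.
  rewrite !indicE; have [ba|ab] := leP `|b| `|a|.
    by rewrite mem_set//= memNset/= ?addr0 ?mulr1// ltNge ba.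
  by rewrite memNset/= ?leNgt ?ab// mem_set//= add0r mulr1.
rewrite ge0_integralD//; last 4 first.
- by move=> a _; exact: integral_ge0.
- exact: (@measurable_fun_fubini_tonelli_F _ _ mR mR R leb h1 mh1 h10).
- by move=> a _; exact: integral_ge0.
- exact: (@measurable_fun_fubini_tonelli_F _ _ mR mR R leb h2 mh2 h20).
have -> : (\int[mu]_a \int[mu]_b h1 (a, b) = \int[mu]_a e a)%E.
  apply: eq_integral => a _; rewrite -square_triangle [RHS]integral_mkcond.
  apply: eq_integral => b _; rewrite patchE /h1 indicE.
  rewrite (_ : (a, b) \in _ =
    (b \in `[(- `|a|)%R, `|a|%R]%classic)); last first.
    by apply/idP/idP; rewrite !inE/= in_itv/= ler_norml.
  by case: ifPn => _; rewrite ?mulr1 ?mulr0.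
have -> : (\int[mu]_a \int[mu]_b h2 (a, b) = \int[mu]_a e a)%E.
  transitivity (\int[leb]_b \int[leb]_a h2 (a, b))%E.
    exact: (@fubini_tonelli _ _ mR mR R leb leb h2 mh2 h20).
  apply: eq_integral => b _; rewrite -square_open_triangle [RHS]integral_mkcond.
  apply: eq_integral => a _; rewrite patchE /h2 indicE square_densityC.
  rewrite (_ : (a, b) \in _ =
    (a \in `](- `|b|)%R, `|b|%R[%classic)); last first.
    by apply/idP/idP; rewrite !inE/= in_itv/= ltr_norml.
  by case: ifPn => _; rewrite ?mulr1 ?mulr0.
rewrite -ge0_integralD//.
rewrite ge0_integral_even; last 3 first.
- exact: emeasurable_funD.
- by move=> x; rewrite adde_ge0.
- have eN x : e (- x) = e x.
    rewrite /e normrN !indicE; congr ((_ * (nat_of_bool _)%:R)%:E).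
    by apply/idP/idP; rewrite !inE/= normrN.
  by move=> x; rewrite eN.
have me2 : measurable_fun (`[0%R, +oo[%classic : set mR) (fun x => e x + e x)%E.
  by apply: measurable_funTS; exact: emeasurable_funD.
rewrite -ge0_integralD//; last 2 first.
- by move=> x _; rewrite adde_ge0.
- by move=> x _; rewrite adde_ge0.
rewrite integral_mkcond [RHS]integral_mkcond; apply: eq_integral => x _.
rewrite !patchE.
have [x01|x01] := boolP (x \in `[0%R, 1%R]%classic).
  move: x01; rewrite inE/= in_itv/= => /andP[x0 x1].
  rewrite mem_set/= ?in_itv/= ?x0//= /e ger0_norm// indicE.
  rewrite mem_set/= ?ger0_norm//.
  by rewrite -!EFinD; congr EFin; lra.
case: ifPn => //; rewrite inE/= in_itv/= andbT => x0.
rewrite /e indicE memNset/= ?mulr0 ?adde0//.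
move: x01; rewrite notin_setE/= in_itv/= x0/= => x1.
by rewrite ger0_norm.
Qed.

End square.

(** * From logarithms to arctangents *)

Section arctangent_form.
Context {R : realType}.
Notation mu := (@lebesgue_measure R).
Notation mR := (measurableTypeR R).
Let leb : {sigma_finite_measure set mR -> \bar R} := @lebesgue_measure R.

(** One function that is a derivative in each variable. With d = sqrt (4 - x^2),
it is the derivative in r of
artanh (x d r / (1 + r^2)) / d, and the derivative in x of
- atan (r (2 - x^2) / (1 - r^2)) / (2 r): the first form of the denominator is
(1 + r^2)^2 - x^2 d^2 r^2, the second is (1 - r^2)^2 + r^2 (2 - x^2)^2. *)
Definition slice_kernel (x r : R) : R :=
  x * (1 - r ^+ 2) / ((1 - r ^+ 2) ^+ 2 + r ^+ 2 * (2 - x ^+ 2) ^+ 2).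

Lemma slice_kernel_den_gt0 (x r : R) : 0 <= x <= 1 ->
  0 < (1 - r ^+ 2) ^+ 2 + r ^+ 2 * (2 - x ^+ 2) ^+ 2.
Proof.
move=> /andP[x0 x1]; have [->|r0] := eqVneq r 0; first by rewrite expr0n/=; lra.
rewrite ltr_wpDl ?sqr_ge0// mulr_gt0// exprn_even_gt0//=.
by rewrite gt_eqF//; nra.
Qed.

(** The antiderivative in r takes at 1 the value
(ln (2 + x d) - ln (2 - x d)) / (2 d), and 2 (2 + x d) = (d + x)^2,
2 (2 - x d) = (d - x)^2 because d^2 + x^2 = 4. *)
Lemma integral_slice_kernel_r (x : R) : 0 <= x <= 1 ->
  (\int[mu]_(r in `]0%R, 1%R[) (slice_kernel x r)%:E = (log_slice x)%:E)%E.
Proof.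
move=> x01; have [d2 d0 xd] := sqrt4B x01; move/andP: (x01) => [x0 x1].
rewrite /log_slice; set d := Num.sqrt _ in d2 d0 xd *.
pose s := x * d.
have s2 : s ^+ 2 = x ^+ 2 * (4 - x ^+ 2) by rewrite /s exprMn d2.
have s4 : s ^+ 2 < 4 by rewrite s2; nra.
have pos1 r : 0 < 1 + r ^+ 2 + s * r by have := sqr_ge0 (r + s / 2); nra.
have pos2 r : 0 < 1 + r ^+ 2 - s * r by have := sqr_ge0 (r - s / 2); nra.
pose F (r : R) :=
  (ln (1 + r ^+ 2 + s * r) - ln (1 + r ^+ 2 - s * r)) * (2 * d)^-1.
have dF (r : R) : is_derive r 1 F (slice_kernel x r).
  have d1 : is_derive r 1 (fun z => ln (1 + z ^+ 2 + s * z))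
      ((1 + r ^+ 2 + s * r)^-1 * (2 * r + s)).
    apply: is_derive_ln_comp => //.
    by apply: is_derive_eq; rewrite /GRing.scale/=; ring.
  have d3 : is_derive r 1 (fun z => ln (1 + z ^+ 2 - s * z))
      ((1 + r ^+ 2 - s * r)^-1 * (2 * r - s)).
    apply: is_derive_ln_comp => //.
    by apply: is_derive_eq; rewrite /GRing.scale/=; ring.
  have dB := is_deriveB d1 d3.
  have dk : is_derive r 1 (fun _ : R => (2 * d)^-1) 0 by exact: is_derive_cst.
  apply: is_derive_eq (@is_deriveM R R^o _ _ r 1 _ _ dB dk) _.
  have kernelE : slice_kernel x r =
      s * (1 - r ^+ 2) / ((1 + r ^+ 2 + s * r) * (1 + r ^+ 2 - s * r)) / d.
    rewrite (_ : _ * (1 + r ^+ 2 - s * r) =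
        (1 - r ^+ 2) ^+ 2 + r ^+ 2 * (2 - x ^+ 2) ^+ 2).
      rewrite /slice_kernel /s; move: (slice_kernel_den_gt0 r x01).
      set D := _ ^+ 2 + _ => D0; field.
      by rewrite !gt_eqF.
    transitivity ((1 + r ^+ 2) ^+ 2 - s ^+ 2 * r ^+ 2); first by ring.
    by rewrite s2; ring.
  rewrite kernelE /GRing.scale/=; field.
  by rewrite !gt_eqF.
have cF (r : R) : {for r, continuous (slice_kernel x)}.
  apply: cvgM.
    apply: cvgM; first exact: cvg_cst.
    by apply: cvgB; [exact: cvg_cst|exact: exprn_continuous].
  apply: cvgV; first by rewrite gt_eqF// slice_kernel_den_gt0.
  apply: cvgD.
    apply: (@cvg_comp _ _ _ (fun z : R => 1 - z ^+ 2) (fun z => z ^+ 2));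
      last exact: exprn_continuous.
    by apply: cvgB; [exact: cvg_cst|exact: exprn_continuous].
  by apply: cvgM; [exact: exprn_continuous|exact: cvg_cst].
have mkernel : measurable_fun [set: mR] (fun r => (slice_kernel x r)%:E).
  by apply/measurable_EFinP; rewrite /slice_kernel; mfun.
rewrite -(@integral_itv_bndoo _ _ _ _ true false); last exact: measurable_funTS.
rewrite (integral_derivative ler01 (fun r _ => dF r) (fun r _ => cF r)).
have ln2p : ln (2 + s) = 2 * ln (d + x) - ln 2.
  have -> : 2 + s = (d + x) ^+ 2 / 2.
    have -> : (d + x) ^+ 2 = d ^+ 2 + 2 * s + x ^+ 2 by rewrite /s; ring.
    by rewrite d2; field.
  rewrite ln_div ?posrE ?exprn_gt0//; last lra.
  by rewrite lnXn; [rewrite mulr2n; ring|lra].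
have ln2m : ln (2 - s) = 2 * ln (d - x) - ln 2.
  have -> : 2 - s = (d - x) ^+ 2 / 2.
    have -> : (d - x) ^+ 2 = d ^+ 2 - 2 * s + x ^+ 2 by rewrite /s; ring.
    by rewrite d2; field.
  rewrite ln_div ?posrE ?exprn_gt0//; try lra.
  by rewrite lnXn; [rewrite mulr2n; ring|lra].
rewrite /F expr1n expr0n/= !mulr0 !mulr1 !addr0 subr0 subrr mul0r subr0.
rewrite ln2p ln2m; congr EFin; field.
by rewrite gt_eqF.
Qed.

(** Both sides vanish at 0 and have the same derivative. *)
Lemma atan_identity (r : R) : 0 <= r < 1 ->
  atan (2 * r / (1 - r ^+ 2)) - atan (r / (1 - r ^+ 2)) =
  atan r - atan (r ^+ 3).
Proof.
move=> /andP[r0 r1].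
pose K (s : R) := atan (2 * s / (1 - s ^+ 2)) - atan (s / (1 - s ^+ 2)) -
  (atan s - atan (s ^+ 3)).
have dK (s : R) : 0 <= s <= r -> is_derive s 1 K 0.
  move=> /andP[s0 sr].
  have q0 : 1 - s ^+ 2 != 0 by rewrite gt_eqF//; nra.
  have dq : is_derive s 1 (fun z : R => 1 - z ^+ 2) (- (2 * s)).
    by apply: is_derive_eq; rewrite /GRing.scale/=; ring.
  have n1 : is_derive s 1 (fun z : R => 2 * z) 2.
    by apply: is_derive_eq; rewrite /GRing.scale/=; ring.
  have n2 : is_derive s 1 (fun z : R => z) 1 by exact: is_derive_id.
  have n3 : is_derive s 1 (fun z : R => z ^+ 3) (3 * s ^+ 2).
    by apply: is_derive_eq; rewrite /GRing.scale/=; ring.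
  have d1 := is_derive_atan_comp
    (is_derive_div (g := fun z => 1 - z ^+ 2) q0 n1 dq).
  have d2 := is_derive_atan_comp
    (is_derive_div (g := fun z => 1 - z ^+ 2) q0 n2 dq).
  have d3 := is_derive1_atan s.
  have d4 := is_derive_atan_comp n3.
  apply: is_derive_eq (is_deriveB (is_deriveB d1 d2) (is_deriveB d3 d4)) _.
  rewrite /GRing.scale/=.
  have q : 0 < 1 - s ^+ 2 by nra.
  field.
  apply/and5P; split=> //.
  - by rewrite gt_eqF// ltr_wpDr// sqr_ge0.
  - by rewrite gt_eqF// ltr_wpDr// sqr_ge0.
  - by rewrite gt_eqF// ltr_wpDr ?sqr_ge0// exprn_gt0.
  - by rewrite gt_eqF// ltr_wpDr ?sqr_ge0// exprn_gt0.
(* a function whose derivative is 0 has a zero increment, by integration *)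
have c0 (s : R) : 0 <= s <= r -> {for s, continuous (fun _ : R => 0 : R)}.
  by move=> _; exact: cvg_cst.
have : (K r - K 0)%:E = 0%:E :> \bar R.
  by rewrite -(integral_derivative r0 dK c0) integral0_eq.
move=> -[]; rewrite /K !mulr0 !mul0r expr0n/= !atan0 !subr0 => /eqP.
by rewrite subr_eq0 => /eqP.
Qed.

Lemma integral_slice_kernel_x (r : R) : 0 < r < 1 ->
  (\int[mu]_(x in `[0%R, 1%R]) (slice_kernel x r)%:E =
   ((atan r - atan (r ^+ 3)) / (2 * r))%:E)%E.
Proof.
move=> /andP[r0 r1].
have q : 0 < 1 - r ^+ 2 by nra.
pose F (x : R) := atan (r / (1 - r ^+ 2) * (2 - x ^+ 2)) * - (2 * r)^-1.
have dF (x : R) : 0 <= x <= 1 -> is_derive x 1 F (slice_kernel x r).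
  move=> x01; have D0 := slice_kernel_den_gt0 r x01.
  have n1 : is_derive x 1 (fun z : R => r / (1 - r ^+ 2) * (2 - z ^+ 2))
      (r / (1 - r ^+ 2) * (- (2 * x))).
    by apply: is_derive_eq; rewrite /GRing.scale/=; ring.
  have dk : is_derive x 1 (fun _ : R => - (2 * r)^-1) 0 by exact: is_derive_cst.
  apply: is_derive_eq
    (@is_deriveM R R^o _ _ x 1 _ _ (is_derive_atan_comp n1) dk) _.
  rewrite /GRing.scale/= /slice_kernel.
  have -> : 1 + (r / (1 - r ^+ 2) * (2 - x ^+ 2)) ^+ 2 =
    ((1 - r ^+ 2) ^+ 2 + r ^+ 2 * (2 - x ^+ 2) ^+ 2) / (1 - r ^+ 2) ^+ 2.
    by field; rewrite gt_eqF.
  move: D0; set D := _ ^+ 2 + _ => D0; field.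
  by rewrite !gt_eqF.
have cF (x : R) : 0 <= x <= 1 -> {for x, continuous (slice_kernel^~ r)}.
  move=> x01; apply: cvgM.
    by apply: cvgM; [exact: cvg_id|exact: cvg_cst].
  apply: cvgV; first by rewrite gt_eqF// slice_kernel_den_gt0.
  apply: cvgD; first exact: cvg_cst.
  apply: cvgM; first exact: cvg_cst.
  apply: (@cvg_comp _ _ _ (fun z : R => 2 - z ^+ 2) (fun z => z ^+ 2));
    last exact: exprn_continuous.
  by apply: cvgB; [exact: cvg_cst|exact: exprn_continuous].
rewrite (integral_derivative ler01 dF cF) -atan_identity ?r1 ?andbT ?(ltW r0)//.
rewrite /F expr1n expr0n/= subr0; congr EFin.
have -> : (2 - 1 : R) = 1 by lra.
rewrite mulr1 (_ : r / (1 - r ^+ 2) * 2 = 2 * r / (1 - r ^+ 2)); last first.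
  by field; rewrite gt_eqF.
by field; rewrite gt_eqF.
Qed.

Lemma integral_log_slice_atan :
  (\int[mu]_(x in `[0%R, 1%R]) (log_slice x)%:E =
   \int[mu]_(r in `]0%R, 1%R[) ((atan r - atan (r ^+ 3)) / (2 * r))%:E)%E.
Proof.
pose Psi (z : R * R) : \bar R := (slice_kernel z.1 z.2 *
  \1_[set z : R * R | [&& 0 <= z.1, z.1 <= 1, 0 < z.2 & z.2 < 1]] z)%:E.
have mPsi : measurable_fun [set: mR * mR] Psi.
  apply/measurable_EFinP; apply: measurable_funM.
    by rewrite /slice_kernel; mfun.
  by apply: measurable_indic; apply: measurable_bool_set; mbool.
have Psi0 z : (0 <= Psi z)%E.
  rewrite /Psi lee_fin indicE.
  have [|_] := boolP (z \in _); last by rewrite mulr0.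
  rewrite inE/= => /and4P[z0 z1 z2 z3]; rewrite mulr1 /slice_kernel divr_ge0//.
    by rewrite mulr_ge0//; nra.
  by rewrite ltW// slice_kernel_den_gt0// z0.
have PsiE x r : Psi (x, r) =
    ((fun x => ((fun r => (slice_kernel x r)%:E) \_ `]0%R, 1%R[) r)
      \_ `[0%R, 1%R]) x.
  rewrite /Psi !patchE indicE.
  have [x01|x01] := boolP (x \in `[0%R, 1%R]%classic); last first.
    rewrite memNset ?mulr0//= => /and4P[x0 x1 _ _].
    by move: x01; rewrite notin_setE/= in_itv/= x0 x1.
  move: x01; rewrite inE/= in_itv/= => /andP[x0 x1].
  have [r01|r01] := boolP (r \in `]0%R, 1%R[%classic); last first.
    rewrite memNset ?mulr0//= => /and4P[_ _ r0 r1].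
    by move: r01; rewrite notin_setE/= in_itv/= r0 r1.
  move: r01; rewrite inE/= in_itv/= => /andP[r0 r1].
  by rewrite mem_set ?mulr1//=; apply/and4P.
transitivity (\int[leb]_x \int[leb]_r Psi (x, r))%E.
  rewrite integral_mkcond; apply: eq_integral => x _; rewrite patchE.
  case: ifPn => x01.
    move: (x01); rewrite inE/= in_itv/= => x01'.
    rewrite -integral_slice_kernel_r// integral_mkcond.
    apply: eq_integral => r _.
    by rewrite PsiE [RHS]patchE x01.
  by rewrite integral0_eq// => r _; rewrite PsiE patchE (negbTE x01).
transitivity (\int[leb]_r \int[leb]_x Psi (x, r))%E.
  exact: (@fubini_tonelli _ _ mR mR R leb leb Psi mPsi Psi0).
rewrite [RHS]integral_mkcond; apply: eq_integral => r _; rewrite patchE.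
case: ifPn => r01.
  move: (r01); rewrite inE/= in_itv/= => r01'.
  rewrite -integral_slice_kernel_x// [RHS]integral_mkcond.
  apply: eq_integral => x _.
  by rewrite PsiE !patchE r01.
rewrite integral0_eq// => x _; rewrite PsiE !patchE (negbTE r01).
by case: ifP.
Qed.

End arctangent_form.

(** * Catalan's constant *)

Section catalan_series.
Context {R : realType}.
Notation mu := (@lebesgue_measure R).
Notation mR := (measurableTypeR R).

Lemma derive_ge0_le (F f : R -> R) (a b : R) : a <= b ->
  (forall x, a <= x <= b -> is_derive x 1 F (f x)) ->
  (forall x, a <= x <= b -> 0 <= f x) -> F a <= F b.
Proof.
move=> ab dF f0.
have [||c] := @MVT_segment R F f a b ab.
- by move=> x /[!in_itv]/= /andP[ax xb]; apply: dF; rewrite !ltW.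
- apply: continuous_in_subspaceT => x; rewrite inE/= in_itv/= => /dF dFx.
  by apply: differentiable_continuous; apply/derivable1_diffP; exact: ex_derive.
by rewrite in_itv/= => /f0 fc E; rewrite -subr_ge0 E mulr_ge0// subr_ge0.
Qed.

(** Taylor polynomial of (atan u) / u. *)
Definition atan_poly N (u : R) : R :=
  \sum_(n < N) (-1) ^+ n / n.*2.+1%:R * u ^+ n.*2.

(** Taylor polynomial of the inverse tangent integral, the antiderivative of
(atan u) / u; its values at 1 are the partial sums of Catalan's constant. *)
Definition ti2_poly N (u : R) : R :=
  \sum_(n < N) (-1) ^+ n / n.*2.+1%:R ^+ 2 * u ^+ n.*2.+1.

Lemma atan_polyS N u : atan_poly N.+1 u =
  atan_poly N u + (-1) ^+ N / N.*2.+1%:R * u ^+ N.*2.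
Proof. by rewrite /atan_poly big_ord_recr. Qed.

Lemma ti2_polyS N u : ti2_poly N.+1 u =
  ti2_poly N u + (-1) ^+ N / N.*2.+1%:R ^+ 2 * u ^+ N.*2.+1.
Proof. by rewrite /ti2_poly big_ord_recr. Qed.

Lemma is_derive_monomial (k : R) n (u : R) :
  is_derive u 1 (fun z : R => k * z ^+ n.+1) (k * n.+1%:R * u ^+ n).
Proof.
have dX : is_derive u 1 (fun z : R => z ^+ n.+1) ((n.+1%:R * u ^+ n) *: 1).
  have := is_deriveX n.+1 (is_derive_id u 1).
  by rewrite (_ : id ^+ n.+1 = (fun z : R => z ^+ n.+1))// exprfctE.
have dk : is_derive u 1 (fun _ : R => k) 0 by exact: is_derive_cst.
have dM := @is_deriveM R R^o _ _ u 1 _ _ dk dX.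
apply: is_derive_eq dM _.
by rewrite /GRing.scale/=; ring.
Qed.

Lemma is_derive_atan_poly N (u : R) :
  is_derive u 1 (fun z : R => z * atan_poly N z)
    ((1 - (- u ^+ 2) ^+ N) / (1 + u ^+ 2)).
Proof.
have u1 : 1 + u ^+ 2 != 0 by rewrite gt_eqF// ltr_wpDr// sqr_ge0.
elim: N => [|N ih].
  rewrite (_ : (fun _ => _) = cst 0).
    by rewrite expr0 subrr mul0r; exact: is_derive_cst.
  by apply/funext => z; rewrite /atan_poly big_ord0 mulr0.
have -> : (fun z : R => z * atan_poly N.+1 z) =
    (fun z => z * atan_poly N z) \+
    (fun z : R => (-1) ^+ N / N.*2.+1%:R * z ^+ N.*2.+1).
  by apply/funext => z /=; rewrite atan_polyS mulrDr exprS; ring.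
apply: is_derive_eq (is_deriveD ih (is_derive_monomial _ _ _)) _.
have -> : u ^+ N.*2 = (-1) ^+ N * (- u ^+ 2) ^+ N.
  by rewrite -exprMn mulN1r opprK -exprM mul2n.
rewrite divfK ?pnatr_eq0// mulrA -exprD addnn -signr_odd odd_double expr0 mul1r.
by rewrite [(- u ^+ 2) ^+ N.+1]exprS; field.
Qed.

Lemma is_derive_ti2_poly N (u : R) : is_derive u 1 (ti2_poly N) (atan_poly N u).
Proof.
elim: N => [|N ih].
  rewrite (_ : ti2_poly 0 = cst 0).
    by rewrite /atan_poly big_ord0; exact: is_derive_cst.
  by apply/funext => z; rewrite /ti2_poly big_ord0.
rewrite (_ : ti2_poly N.+1 = ti2_poly N \+
    (fun z => (-1) ^+ N / N.*2.+1%:R ^+ 2 * z ^+ N.*2.+1)); last first.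
  by apply/funext => z /=; rewrite ti2_polyS.
apply: is_derive_eq (is_deriveD ih (is_derive_monomial _ _ _)) _.
have : N.*2.+1%:R != 0 :> R by rewrite pnatr_eq0.
by rewrite atan_polyS; move: (N.*2.+1%:R) => k k0; congr (_ + _ * _); field.
Qed.

Lemma continuous_atan_poly N : continuous (atan_poly N).
Proof.
elim: N => [|N ih] u.
  rewrite (_ : atan_poly 0 = cst 0); first exact: cvg_cst.
  by apply/funext => z; rewrite /atan_poly big_ord0.
rewrite (_ : atan_poly N.+1 = atan_poly N \+
    (fun z => (-1) ^+ N / N.*2.+1%:R * z ^+ N.*2)); last first.
  by apply/funext => z /=; rewrite atan_polyS.
apply: cvgD; first exact: ih.
by apply: cvgM; [exact: cvg_cst|exact: exprn_continuous].
Qed.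

(** The error has derivative (- s^2)^N / (1 + s^2), a geometric remainder of
absolute value at most s^(2N). *)
Lemma atan_poly_error N (u : R) : 0 <= u ->
  `|atan u - u * atan_poly N u| <= u ^+ N.*2.+1 / N.*2.+1%:R.
Proof.
move=> u0.
pose e (s : R) := (- s ^+ 2) ^+ N / (1 + s ^+ 2).
have dE (s : R) : is_derive s 1 (fun z => atan z - z * atan_poly N z) (e s).
  apply: is_derive_eq
    (is_deriveB (is_derive1_atan s) (is_derive_atan_poly N s)) _.
  by rewrite /e; field; rewrite gt_eqF// ltr_wpDr// sqr_ge0.
have dM (s : R) :
    is_derive s 1 (fun z : R => N.*2.+1%:R^-1 * z ^+ N.*2.+1) (s ^+ N.*2).
  apply: is_derive_eq (is_derive_monomial _ _ _) _.
  by rewrite mulVf ?mul1r ?pnatr_eq0.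
have e_le s : `|e s| <= s ^+ N.*2.
  rewrite /e normrM normrX normrN normfV -mul2n exprM.
  rewrite !ger0_norm ?sqr_ge0 ?addr_ge0 ?sqr_ge0//.
  rewrite ler_pdivrMr; last by rewrite ltr_wpDr ?sqr_ge0.
  by apply: ler_peMr; [rewrite exprn_ge0 ?sqr_ge0|rewrite lerDl sqr_ge0].
have lo s : 0 <= s <= u -> 0 <= s ^+ N.*2 + e s.
  by have := e_le s; rewrite ler_norml; lra.
have hi s : 0 <= s <= u -> 0 <= s ^+ N.*2 - e s.
  by have := e_le s; rewrite ler_norml; lra.
have := derive_ge0_le u0 (fun s _ => is_deriveD (dM s) (dE s)) lo.
have := derive_ge0_le u0 (fun s _ => is_deriveB (dM s) (dE s)) hi.
rewrite !fctE !expr0n/= !(mulr0, mul0r) atan0 !subr0 addr0 => hi' lo'.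
rewrite ler_norml [_ / _]mulrC; apply/andP; split; last by rewrite -subr_ge0.
by rewrite lerNl -subr_ge0 opprK.
Qed.

Lemma ti2_poly_catalan N :
  \sum_(1 <= n < N.+1) ((-1) ^+ n.-1 / (n.*2.-1)%:R ^+ 2 : R) = ti2_poly N 1.
Proof.
rewrite big_add1 /= big_mkord; apply: eq_bigr => n _.
by rewrite expr1n mulr1.
Qed.

(** The integral of [slice_kernel] over its first variable. *)
Definition atan_gap (r : R) : R := (atan r - atan (r ^+ 3)) / (2 * r).

Lemma measurable_atan_gap : measurable_fun [set: mR] atan_gap.
Proof.
have mat : measurable_fun [set: R] (@atan R).
  by apply: continuous_measurable_fun => x; exact: continuous_atan.
apply: measurable_funM; last by mfun.
apply: measurable_funB => //.
by apply: (measurableT_comp mat); exact: measurable_funX.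
Qed.

(* [W N] is an antiderivative of [w N], and [W N 1 = ti2_poly N 1 / 3]: the
   second term of the integrand has a third of the integral of the first. *)
Let w N (r : R) := (atan_poly N r - r ^+ 2 * atan_poly N (r ^+ 3)) / 2.
Let W N (r : R) := ti2_poly N r / 2 - ti2_poly N (r ^+ 3) / 6.
Let eps N : R := N.*2.+1%:R^-1.

Let eps_ge0 N : 0 <= eps N. Proof. by rewrite invr_ge0. Qed.

Let atan_gap_error N r : 0 < r < 1 -> `|atan_gap r - w N r| <= eps N.
Proof.
move=> /andP[r0 r1].
have -> : atan_gap r - w N r =
   ((atan r - r * atan_poly N r) -
    (atan (r ^+ 3) - r ^+ 3 * atan_poly N (r ^+ 3))) / (2 * r).
  by rewrite /atan_gap /w; field; rewrite gt_eqF.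
rewrite normrM normfV (@ger0_norm _ (2 * r)) ?mulr_ge0 ?(ltW r0)//.
rewrite ler_pdivrMr ?mulr_gt0//.
have e1 := atan_poly_error N (ltW r0).
have e3 := atan_poly_error N (exprn_ge0 3 (ltW r0)).
apply: le_trans (ler_normB _ _) _; apply: le_trans (lerD e1 e3) _.
have r_le1 : r ^+ N.*2.+1 <= r by rewrite exprS ger_pMr// exprn_ile1// ltW.
have r3_le1 : (r ^+ 3) ^+ N.*2.+1 <= r.
  apply: le_trans r_le1; rewrite lerXn2r ?nnegrE ?exprn_ge0 ?(ltW r0)//.
  by rewrite exprS ger_pMr// exprn_ile1// ltW.
by rewrite -mulrDl mulrC ler_wpM2l ?eps_ge0//; lra.
Qed.

Let integral_w N :
  (\int[mu]_(r in `]0%R, 1%R[) (w N r + eps N)%:E =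
   (ti2_poly N 1 / 3 + eps N)%:E)%E.
Proof.
have cw (r : R) : {for r, continuous (fun s => w N s + eps N)}.
  apply: cvgD; last exact: cvg_cst.
  apply: cvgM; last exact: cvg_cst.
  apply: cvgB; first exact: continuous_atan_poly.
  apply: cvgM; first exact: exprn_continuous.
  apply: (@cvg_comp _ _ _ (fun s : R => s ^+ 3) (atan_poly N));
    first exact: exprn_continuous.
  exact: continuous_atan_poly.
have dW (r : R) : is_derive r 1 (fun s => W N s + s * eps N) (w N r + eps N).
  have n3 : is_derive r 1 (fun z : R => z ^+ 3) (3 * r ^+ 2).
    by apply: is_derive_eq; rewrite /GRing.scale/=; ring.
  have d3 : is_derive r 1 (fun s => ti2_poly N (s ^+ 3))
      (atan_poly N (r ^+ 3) * (3 * r ^+ 2)).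
    exact: (is_derive1_comp (f := ti2_poly N) (g := fun z : R => z ^+ 3)
      (is_derive_ti2_poly N (r ^+ 3)) n3).
  have d1 := is_derive_ti2_poly N r.
  have k2 : is_derive r 1 (fun _ : R => 2^-1 : R) 0 by exact: is_derive_cst.
  have k6 : is_derive r 1 (fun _ : R => 6^-1 : R) 0 by exact: is_derive_cst.
  have ke : is_derive r 1 (fun _ : R => eps N : R) 0 by exact: is_derive_cst.
  have m1 := @is_deriveM R R^o _ _ r 1 _ _ d1 k2.
  have m3 := @is_deriveM R R^o _ _ r 1 _ _ d3 k6.
  have me := @is_deriveM R R^o _ _ r 1 _ _ (is_derive_id r 1) ke.
  apply: is_derive_eq (is_deriveD (is_deriveB m1 m3) me) _.
  by rewrite /GRing.scale/= /w; field.
have mw : measurable_fun [set: mR] (fun r => (w N r + eps N)%:E).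
  by apply/measurable_EFinP; apply: continuous_measurable_fun => r; exact: cw.
rewrite -(@integral_itv_bndoo _ _ _ _ true false); last exact: measurable_funTS.
rewrite (integral_derivative ler01 (fun r _ => dW r) (fun r _ => cw r)).
congr EFin; rewrite /W expr1n expr0n/= mul0r addr0.
have -> : ti2_poly N 0 = 0.
  by rewrite /ti2_poly big1// => n _; rewrite expr0n/= mulr0.
by field.
Qed.

(** Term-by-term integration with an explicit error: on ]0, 1[ the integrand
differs from [w N] by at most 1 / (2N + 1), so its integral differs by as much
from a third of the N-th partial sum. *)
Lemma integral_atan_gap :
  (\int[mu]_(r in `]0%R, 1%R[) (atan_gap r)%:E = (catalan R / 3)%:E)%E.
Proof.
set J := (X in X = _).
have g0 r : 0 < r < 1 -> 0 <= atan_gap r.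
  move=> /andP[r0 r1]; rewrite divr_ge0 ?mulr_ge0 ?(ltW r0)//.
  rewrite subr_ge0 le_atan// -[leRHS]expr1 ler_wiXn2l// ltW//.
have J0 : (0 <= J)%E.
  by apply: integral_ge0 => r; rewrite /= in_itv/= => r01; rewrite lee_fin g0.
have mg : measurable_fun (`]0%R, 1%R[%classic : set mR)
    (fun r => (atan_gap r)%:E).
  apply: measurable_funTS; apply/measurable_EFinP.
  exact: measurable_atan_gap.
have mw N : measurable_fun (`]0%R, 1%R[%classic : set mR)
    (fun r => (w N r + eps N)%:E).
  apply: measurable_funTS; apply/measurable_EFinP; apply: measurable_funD => //.
  apply: measurable_funM => //; apply: measurable_funB.
    by apply: continuous_measurable_fun; exact: continuous_atan_poly.
  apply: measurable_funM; first by mfun.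
  apply: (@measurableT_comp _ _ _ _ _ _ (atan_poly N)); last by mfun.
  by apply: continuous_measurable_fun; exact: continuous_atan_poly.
have err N r : 0 < r < 1 -> w N r - eps N <= atan_gap r <= w N r + eps N.
  by move=> /(atan_gap_error N); rewrite ler_norml; lra.
(* adding [eps N] makes [w N] nonnegative, so that integrals of nonnegative
   functions are compared throughout *)
have upper N : (J <= (ti2_poly N 1 / 3 + eps N)%:E)%E.
  rewrite -integral_w; apply: ge0_le_integral => //.
  move=> r; rewrite /= in_itv/= => r01; rewrite lee_fin.
  by case/andP: (err N r r01).
have lower N : ((ti2_poly N 1 / 3 + eps N)%:E <= J + (2 * eps N)%:E)%E.
  rewrite -integral_w.
  have -> : ((2 * eps N)%:E = \int[mu]_(r in `]0%R, 1%R[) (2 * eps N)%:E)%E.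
    by rewrite integral_cst//= lebesgue_measure_itv/= lte01 oppr0 adde0 mule1.
  rewrite -ge0_integralD//; last by move=> r _; rewrite lee_fin mulr_ge0.
  apply: ge0_le_integral => //.
  - move=> r; rewrite /= in_itv/= => r01; rewrite lee_fin.
    by have := err N r r01; have := g0 r r01; lra.
  - exact: emeasurable_funD.
  - move=> r; rewrite /= in_itv/= => r01; rewrite -EFinD lee_fin.
    by have := err N r r01; lra.
have Jfin : J \is a fin_num.
  by rewrite ge0_fin_numE// (le_lt_trans (upper 0%N))// ltry.
rewrite -(fineK Jfin) in upper lower *.
congr EFin; apply: (@mulfI _ 3) => //; rewrite mulrCA mulfV// mulr1.
apply/esym/cvg_lim => //; rewrite -cvg_shiftS /=.
under eq_fun do rewrite ti2_poly_catalan.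
apply/cvgrPdist_le => e e0; have e3 : 0 < e / 3 by rewrite divr_gt0.
near=> N.
have := upper N; have := lower N; rewrite -EFinD !lee_fin => lo up.
have epsE : eps N <= N.+1%:R^-1.
  by rewrite lef_pV2 ?posrE// ler_nat ltnS -addnn leq_addr.
have epsN : eps N < e / 3.
  apply: le_lt_trans epsE _; near: N.
  exact: (near_infty_natSinv_lt (PosNum e3)).
move: (eps N) (ti2_poly N 1) (fine J) lo up epsN => E S j lo up epsN.
by rewrite ler_norml; lra.
Unshelve. all: by end_near. Qed.

End catalan_series.

(** * The density of (xi_R, xi_I) *)

Lemma reduced_domain_mass (R : realType) :
  (\int[lebesgue3 R]_v (v.1.1 * \1_(@reduced_domain R) v)%:E
   = (catalan R / 3)%:E)%E.
Proof.
by rewrite mass_square integral_square_density integral_log_slice_atan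
  integral_atan_gap.
Qed.

Lemma normalizing_constant (R : realType) (c : R) : 0 <= c ->
  (\int[lebesgue3 R]_v (c * v.1.1 * \1_(@reduced_domain R) v)%:E = 1)%E ->
  0 < catalan R /\ c = 3 / catalan R.
Proof.
move=> c0.
under eq_integral do rewrite -mulrA EFinM.
rewrite ge0_integralZl//; last 2 first.
- apply/measurable_EFinP; apply: measurable_funM; first by mfun.
  by apply: measurable_indic; exact: measurable_reduced_domain.
- move=> -[[t y1] y2] _; rewrite lee_fin indicE.
  have [|_] := boolP (_ \in _); last by rewrite mulr0.
  by rewrite inE => -[/ltW t0 _ _ _]; rewrite mulr1.
rewrite reduced_domain_mass -EFinM => -[] cC.
have C0 : 0 < catalan R.
  rewrite ltNge; apply/negP => C0.
  have : c * (catalan R / 3) <= 0 by rewrite mulr_ge0_le0//; lra.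
  by rewrite cC ler10.
split => //; apply: (@mulIf _ (catalan R / 3)).
  by rewrite gt_eqF ?divr_gt0.
by rewrite cC; field; rewrite gt_eqF.
Qed.

Theorem proposition17 (R : realType) (d : measure_display)
    (T : measurableType d) (P : probability T R)
    (t y1 y2 : {RV P >-> R})
    (Hdens : exists c : R,
      has_density P (lebesgue3 R) (fun w => (t w, y1 w, y2 w))
        (fun v => c * v.1.1 * \1_(@reduced_domain R) v)) :
  let s := fun w => Num.sqrt (y1 w ^+ 2 + y2 w ^+ 2 + 1 / t w ^+ 2) in
  let xiR := fun w => y1 w / s w in
  let xiI := fun w => y2 w / s w in
  has_density P (lebesgue2 R) (fun w => (xiR w, xiI w)) (@xi_density R).
Proof.
move=> s xiR xiI; case: Hdens => c [mX mf f0 PX].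
have c0 : 0 <= c.
  have := f0 (1, 0, 0); rewrite /= mulr1 indicE mem_set ?mulr1//.
  by rewrite /reduced_domain /= !normr0 !mulr0 !expr0n/= !expr1n; split; lra.
have [C0 cE] : 0 < catalan R /\ c = 3 / catalan R.
  apply: normalizing_constant => //; rewrite -PX//.
  by rewrite /pushforward preimage_setT probability_setT.
split.
- exact: (measurableT_comp (@measurable_xi_map R) mX).
- rewrite (_ : @xi_density R = fun z : R * R => - (3 / catalan R) *
    (ln (4 * max_sq z.1 z.2) / (4 * (1 - z.1 ^+ 2 - z.2 ^+ 2) ^+ 2)) *
    \1_[set p : R * R | max_sq p.1 p.2 <= 1 / 4] z); last first.
    by apply/funext => -[].
  apply: measurable_funM; first by rewrite /max_sq; mfun.
  apply: measurable_indic; apply: measurable_bool_set.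
  by rewrite /max_sq; mbool.
- move=> -[x y]; rewrite /xi_density indicE.
  have [|_] := boolP (_ \in _); last by rewrite mulr0.
  rewrite inE /= => m1; rewrite mulr1 mulNr -mulrN -mulNr.
  rewrite -cE mulr_ge0// divr_ge0//; last first.
    by apply: mulr_ge0 => //; exact: sqr_ge0.
  by rewrite oppr_ge0 ln_le0//; lra.
move=> A mA.
have mpre : measurable (@xi_map R @^-1` A).
  by rewrite -[X in measurable X]setTI; exact: measurable_xi_map.
transitivity (\int[lebesgue3 R]_(v in @xi_map R @^-1` A)
    (c * v.1.1 * \1_(@reduced_domain R) v)%:E)%E; first exact: PX.
rewrite [RHS]integral_mkcond.
transitivity (\int[lebesgue3 R]_v
   (c * v.1.1 * \1_(@reduced_domain R) v * \1_A (xi_map v))%:E)%E.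
  apply: (etrans (@integral_mkcond _
    (measurableTypeR R * measurableTypeR R * measurableTypeR R)%type R
    (lebesgue3 R) _ _)).
  apply: eq_integral => v _; rewrite patchE [X in _ = (_ * X)%:E]indicE.
  rewrite (_ : (v \in _) = (xi_map v \in A)); last first.
    by apply/idP/idP; rewrite !inE.
  by case: ifPn => _; rewrite ?mulr1 ?mulr0.
rewrite integral_xi_map//; apply: eq_integral => -[x y] _.
rewrite patchE [X in (_ * X)%:E = _]indicE.
case: ifPn => _; rewrite ?mulr0// mulr1 /xi_density; congr EFin.
by rewrite -cE /=; ring.
Qed.
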